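(* Let $s>0$ and $L>0$ be fixed, and for each $n$ let $Y^n=(Y_i)_{i\ge1}$ with $$Y_i=f_i+\frac{\epsilon_i}{\sqrt n},\qquad \epsilon_i\overset{iid}{\sim}\mathcal{N}(0,1),\quad i\ge1,$$ where $f=(f_i)_{i\ge 1}\in\ell^2$. Let $(v_n)$ be any sequence increasing to infinity, and let $\rho_n=v_n n^{-2s/(4s+1)}$ and $k_n=\lfloor n^{2/(4s+1)}\rfloor$. Let $(s_1,s_2,\dots)$ be any increasing sequence of positive reals such that $s_{k_n}\le n^{4s/(4s+1)}$ and $\sum_{i=1}^{k_n}\frac{1}{n+s_i}\le\rho_n/4$. Let $\Pi$ be the prior on $f$ under which $(f_1,\dots,f_{k_n})\sim\bigotimes_{i=1}^{k_n}\mathcal{N}(0,s_i^{-1})$ and $f_j=0$ for all $j>k_n$. Let $\gamma_0,\gamma_1>0$ be fixed. Then there is a constant $C>0$ such that, for $\tau_n>0$ defined by $$\tau_n^2=\frac{C\rho_n^2}{2}+\frac{k_n}{n}+\sum_{i=1}^{k_n}\frac{1}{n+s_i},$$ the test $\delta_n^\pi$ equal to $0$ if $\Pi\{\|f\|_2\le\tau_n\mid Y^n\}\ge\frac{\gamma_0}{\gamma_0+\gamma_1}$ and equal to $1$ otherwise satisfies, as $n\to\infty$, $$\mathrm{E}_0^n(\delta_n^\pi)=o(1)\quad\text{and}\quad\sup_{f\in W_2^s(L),\ f\neq0,\ \|f\|_2>\rho_n}\mathrm{E}_f^n(1-\delta_n^\pi)=o(1).$$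
   Context: $\ell^2=\{g=(g_i)_{i\ge1}:\sum_i g_i^2<\infty\}$ with norm $\|f\|_2=(\sum_i f_i^2)^{1/2}$, and $W_2^s(L)=\{f\in\ell^2:\sum_{i=1}^\infty f_i^2 i^{2s}\le L\}$. $\Pi(\cdot\mid Y^n)$ is the posterior distribution of $f$ given $Y^n$, and $\mathrm{E}_f^n$ is expectation when the data are generated with signal $f$ ($\mathrm{E}_0^n$ for $f=0$). The test concerns $H_0:f=0$ versus $H_1: f\in W_2^s(L)$, $f\ne0$. *)

(* Defs.v *)
From HB Require Import structures.
From mathcomp Require Export all_boot all_order all_algebra.
From mathcomp Require Export all_classical all_reals all_analysis.

#[export] Set Implicit Arguments.
#[export] Unset Strict Implicit.
#[export] Unset Printing Implicit Defensive.

Export Order.TTheory GRing.Theory Num.Theory.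
Export numFieldNormedType.Exports.

Local Open Scope classical_set_scope.
Local Open Scope ring_scope.

(* Sequences are indexed from 0: [f i] is the (i+1)-th coordinate of the
   mathematical sequence, and likewise for noises, observations and prior
   precisions. *)

Section SequenceSpace.
Variable R : realType.

(* Extended-real valued, so that it equals +oo exactly outside of l^2. *)
Definition l2norm (f : nat -> R) : \bar R :=
  sqrte (\sum_(0 <= i <oo) ((f i) ^+ 2)%:E)%E.

Definition ell2 : set (nat -> R) := [set f | (l2norm f < +oo)%E].

Definition sobolev (s L : R) : set (nat -> R) :=
  [set f | ell2 f /\
    (\sum_(0 <= i <oo) ((f i) ^+ 2 * i.+1%:R `^ (2 * s))%:E <= L%:E)%E].

Definition cylinders : set (set (nat -> R)) :=
  [set C | exists i (B : set R), measurable B /\ C = [set f | B (f i)]].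

(* R^N with the product sigma-algebra. *)
Definition seqspace := g_sigma_algebraType cylinders.

End SequenceSpace.

Section Model.
Variable R : realType.

Definition mutually_independent d (T : measurableType d) (P : probability T R)
    (X : nat -> {RV P >-> R}) :=
  forall (J : seq nat) (B : nat -> set R), uniq J ->
    (forall i, measurable (B i)) ->
    P (\bigcap_(i in [set` J]) (X i @^-1` B i)) =
    (\prod_(i <- J) P (X i @^-1` B i))%E.

(* [normal_prob m sigma] takes the standard deviation [sigma]. *)
Definition iid_standard_normal d (T : measurableType d) (P : probability T R)
    (X : nat -> {RV P >-> R}) :=
  mutually_independent X /\
  forall i (B : set R), measurable B ->
    distribution P (X i) B = normal_prob 0 1 B.

Definition observation d (T : measurableType d) (P : probability T R)
    (eps : nat -> {RV P >-> R}) (n : nat) (f : nat -> R) (w : T) : nat -> R :=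
  fun i => f i + eps i w / Num.sqrt n%:R.

(* Law on sequences whose first [k] coordinates have the product law of the
   N(0, 1 / prec i) and whose other coordinates vanish; the product law is
   determined by its values on rectangles. *)
Definition truncated_gaussian_prior (k : nat) (prec : nat -> R)
    (Pi : probability (seqspace R) R) :=
  (forall B : nat -> set R, (forall i, measurable (B i)) ->
     Pi [set f | forall i, (i < k)%N -> B i (f i)] =
     (\prod_(i < k) normal_prob 0 (Num.sqrt (prec i)^-1) (B i))%E) /\
  Pi [set f | forall i, (k <= i)%N -> f i = 0] = 1%E.

(* Density at [y] of the law of the observations under the signal [f] with
   respect to their law under the signal 0, as the limit of the likelihood
   ratios of the first [N] observations.  The limit exists for almost all [y]
   when [f] is in l^2, and for all [y] when [f] is finitely supported (the
   sequence is then eventually constant); taking the upper limit makes the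
   function total. *)
Definition likelihood (n : nat) (f y : nat -> R) : \bar R :=
  limn_esup (fun N : nat =>
    (\prod_(i < N) (normal_pdf (f i) (Num.sqrt n%:R)^-1 (y i) /
                    normal_pdf 0 (Num.sqrt n%:R)^-1 (y i)))%:E).

(* Bayes' formula. *)
Definition posterior (Pi : probability (seqspace R) R) (n : nat)
    (y : nat -> R) (A : set (seqspace R)) : R :=
  fine (\int[Pi]_(f in A) likelihood n f y)%E /
  fine (\int[Pi]_f likelihood n f y)%E.

Definition bayes_test (g0 g1 : R) (Pi : probability (seqspace R) R)
    (n : nat) (tau : R) (y : nat -> R) : R :=
  if g0 / (g0 + g1) <= posterior Pi n y [set f | (l2norm f <= tau%:E)%E]
  then 0 else 1.

Definition type1_error d (T : measurableType d) (P : probability T R)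
    (eps : nat -> {RV P >-> R}) (n : nat) (test : (nat -> R) -> R) : \bar R :=
  ('E_P[fun w => test (observation eps n (fun=> 0%R) w)])%E.

(* The supremum is taken in [0, +oo], so that it is 0 when no signal of the
   class has norm larger than [r]. *)
Definition type2_error d (T : measurableType d) (P : probability T R)
    (eps : nat -> {RV P >-> R}) (n : nat) (s L r : R)
    (test : (nat -> R) -> R) : \bar R :=
  maxe 0%:E (ereal_sup
    [set ('E_P[fun w => (1 - test (observation eps n f w))%R])%E |
      f in [set f | [/\ sobolev s L f, f <> (fun=> 0%R) &
                        (r%:E < l2norm f)%E]]])%E.

Definition separation_rate (s : R) (v : nat -> R) (n : nat) : R :=
  v n * n%:R `^ (- (2 * s / (4 * s + 1))).

Definition cutoff (s : R) (n : nat) : nat :=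
  Num.truncn (n%:R `^ (2 / (4 * s + 1)) : R).

Definition test_radius (s C : R) (v prec : nat -> R) (n : nat) : R :=
  Num.sqrt (C * separation_rate s v n ^+ 2 / 2 + (cutoff s n)%:R / n%:R +
            \sum_(i < cutoff s n) (n%:R + prec i)^-1).

End Model.

(* Main.v *)
From HB Require Import structures.
Require Import Defs.
From mathcomp Require Import all_boot all_order all_algebra.
From mathcomp Require Import all_classical all_reals all_analysis.
From mathcomp Require Import measurable_realfun interval_inference ring lra.
Import HBNNSimple.

(* By conjugacy, the coordinates of [f] are independent under the posterior,
   with laws N(a_i y_i, 1 / (n + s_i)), a_i = n / (n + s_i).  Hence |f|^2 has
   posterior mean S(y) + sum_i 1 / (n + s_i), S(y) = sum_i (a_i y_i)^2, and its
   posterior variance is O(S(y) / n + k / n^2).  Under P_f, S is again a sum of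
   independent squares, with mean sum_i a_i^2 (f_i^2 + 1 / n) and variance
   O(|f|^2 / n + k / n^2).  The data put S close to its mean by Chebyshev's
   inequality; a second Chebyshev inequality, under the posterior, then compares
   |f| with tau_n.  Writing q = n^(-4s / (4s + 1)), one has k / n^2 <= q^2,
   1 / n <= q and rho_n^2 = v_n^2 q, so all deviations are of order q while the
   threshold gap is of order v_n^2 q under H_0 and |f|^2 under H_1; there the
   coordinates beyond k carry at most L q of |f|^2. *)

Local Open Scope classical_set_scope.
Local Open Scope ring_scope.

(** * Measures with a density *)

(** Independence, for the noise as for the prior, is given only through the measure of rectangles,
    so the factorization of expectations behind Chebyshev's inequality has to be derived from there.
    All integrands are nonnegative (squares and products of squares), so sums and integrals can be
    exchanged freely. Two terms of tau_n^2 only recentre: sum_i 1 / (n + s_i) cancels exactly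
    against the same term of the posterior mean of |f|^2, and k / n is the noise part of the mean of
    S up to shrinkage. Shrinkage costs at most 3 q there, because s_i <= 1 / q for i <= k. What
    remains of tau_n^2 is C rho_n^2 / 2, to be compared with the deviations. The posterior variance
    is random through S, but S is bounded wherever the data deviation is small. Both errors are then
    at most a polynomial without constant term in one number x tending to 0: the ratio of q to the
    deviation under H_0, and under H_1 a bound on q / F, where F is the sum of f_i^2 over i <= k.
    That bound does not depend on f, which gives the supremum. *)

(* The hypotheses on [h] are arguments so that the measure structure below can be
   inferred from the term. *)
Definition density d (T : measurableType d) (R : realType)
    (mu : {measure set T -> \bar R}) (h : T -> R)
    (h0 : forall x, 0 <= h x) (mh : measurable_fun setT h) (A : set T) :=
  (\int[mu]_(x in A) (h x)%:E)%E.

Section density.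
Context d (T : measurableType d) (R : realType).
Variables (mu : {measure set T -> \bar R}) (h : T -> R).
Hypotheses (h0 : forall x, 0 <= h x) (mh : measurable_fun setT h).
Local Open Scope ereal_scope.

Local Notation nu := (density mu h0 mh).

Let density0 : nu set0 = 0.
Proof. by rewrite /density integral_set0. Qed.

Let density_ge0 A : 0 <= nu A.
Proof. by apply: integral_ge0 => x _; rewrite lee_fin. Qed.

Let density_sigma_additive : semi_sigma_additive nu.
Proof.
move=> /= A mA tA mUA; rewrite /density ge0_integral_bigcup//=.
- by apply: is_cvg_ereal_nneg_natsum_cond => n _ _; exact: density_ge0.
- exact/measurable_EFinP/measurable_funTS.
- by move=> x _; rewrite lee_fin.
Qed.

HB.instance Definition _ := isMeasure.Build _ _ _
  nu density0 density_ge0 density_sigma_additive.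

(** Monotone approximation of [f] by simple functions, applied to both sides, reduces the claim to
    indicators of level sets, where it is the definition of the density. *)
Lemma integral_density (f : T -> R) :
  (forall x, 0 <= f x)%R -> measurable_fun setT f ->
  \int[nu]_x (f x)%:E = \int[mu]_x (f x * h x)%:E.
Proof.
move=> f0 mf.
have mEf : measurable_fun setT (EFin \o f) by exact/measurable_EFinP.
pose F := nnsfun_approx measurableT mEf.
have ndF x : nondecreasing_seq (fun n => F n x).
  by move=> m n mn; exact/lefP/nd_nnsfun_approx.
have cF x : (F n x)%:E @[n --> \oo] --> (f x)%:E.
  by apply: cvg_nnsfun_approx => // y _; rewrite lee_fin.
have mFh n : measurable_fun setT (fun x => (F n x * h x)%:E).
  exact/measurable_EFinP/measurable_funM.
transitivity (limn (fun n => \int[nu]_x (F n x)%:E)).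
  rewrite -monotone_convergence//.
  - by apply: eq_integral => x _; apply/esym/cvg_lim.
  - by move=> n; exact/measurable_EFinP.
  - by move=> n x _; rewrite lee_fin.
  - by move=> x _ m n mn; rewrite lee_fin; exact: ndF.
transitivity (limn (fun n => \int[mu]_x (F n x * h x)%:E)); last first.
  rewrite -monotone_convergence//.
  - apply: eq_integral => x _; apply/cvg_lim => //.
    under eq_fun do rewrite EFinM.
    rewrite EFinM; apply: cvgeZr => //.
  - by move=> n x _; rewrite lee_fin mulr_ge0.
  - by move=> x _ m n mn; rewrite lee_fin ler_wpM2r//; exact: ndF.
congr (limn _); apply/funext => n.
transitivity (\sum_(r \in range (F n)) \int[nu]_x (r * \1_(F n @^-1` [set r]) x)%:E).
  under eq_integral do rewrite fimfunE -fsumEFin//.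
  rewrite ge0_integral_fsum//.
  - by move=> r; exact/measurable_EFinP/measurable_funM.
  - by move=> r x _; rewrite nnfun_muleindic_ge0.
transitivity (\sum_(r \in range (F n))
    \int[mu]_x (r * \1_(F n @^-1` [set r]) x * h x)%:E); last first.
  rewrite -ge0_integral_fsum//.
  - apply: eq_integral => x _; rewrite [in RHS]fimfunE fsumEFin//; congr EFin.
    by rewrite mulr_fsuml.
  - by move=> r; apply/measurable_EFinP/measurable_funM => //; exact: measurable_funM.
  - by move=> r x _; rewrite lee_fin mulr_ge0// -lee_fin EFinM nnfun_muleindic_ge0.
apply: eq_fsbigr => r; rewrite inE => -[x _ <-].
rewrite integralZl_indic_nnsfun// integral_indic// setIT.
under [RHS]eq_integral do rewrite -mulrA EFinM.
rewrite ge0_integralZl//; last 3 first.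
- by apply/measurable_EFinP/measurable_funM.
- by move=> y _; rewrite lee_fin mulr_ge0.
- by rewrite lee_fin.
congr (_ * _); rewrite /= /density integral_mkcond; apply: eq_integral => y _.
rewrite patchE; rewrite indicE; case: ifP => _ /=; by rewrite ?mul1r ?mul0r.
Qed.

(** Meant for [X] a single coordinate and [h] a product of functions of the other coordinates:
    proportionality on sets, available by induction, passes to integrals. *)
Lemma density_pushforward d' (U : measurableType d') (X : T -> U)
    (N : {measure set U -> \bar R}) (c : R) :
  measurable_fun setT X -> (0 <= c)%R ->
  (forall B, measurable B -> nu (X @^-1` B) = c%:E * N B) ->
  forall g : U -> R, (forall x, 0 <= g x)%R -> measurable_fun setT g ->
  \int[mu]_x (g (X x) * h x)%:E = c%:E * \int[N]_x (g x)%:E.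
Proof.
move=> mX c0 XN g g0 mg.
rewrite -integral_density//; last exact: measurableT_comp.
have -> : c = (NngNum c0)%:num by [].
rewrite -ge0_integral_mscale//; last 2 first.
- exact/measurable_EFinP.
- by move=> x _; rewrite lee_fin.
transitivity (\int[pushforward nu X]_x (g x)%:E).
  rewrite ge0_integral_pushforward//; first exact/measurable_EFinP.
  by move=> x _; rewrite lee_fin.
by apply: eq_measure_integral => A mA _; rewrite [LHS]XN.
Qed.

End density.

(** * Sums of functions of independent variables *)

Section independence.
Context d d' (T : measurableType d) (U : measurableType d') (R : realType).
Variables (P : probability T R) (k : nat) (X : nat -> T -> U).
Variable N : nat -> probability U R.
Hypothesis mX : forall i, measurable_fun setT (X i).
Hypothesis rectX : forall B : nat -> set U, (forall i, measurable (B i)) ->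
  P [set w | forall i, (i < k)%N -> B i (X i w)] = (\prod_(i < k) N i (B i))%E.
Local Open Scope ereal_scope.

Lemma prod_ge0_fin (I : finType) (Q : pred I) (F : I -> \bar R) :
  (forall i, Q i -> 0 <= F i < +oo) ->
  exists2 c : R, (0 <= c)%R & \prod_(i | Q i) F i = c%:E.
Proof.
move=> h; apply: (big_ind (fun x => exists2 c : R, (0 <= c)%R & x = c%:E)).
- by exists 1%R.
- by move=> _ _ [a a0 ->] [b b0 ->]; exists (a * b)%R; rewrite ?mulr_ge0// EFinM.
- move=> i /h /andP[F0 Foo]; exists (fine (F i)); first exact: fine_ge0.
  by rewrite fineK// ge0_fin_numE.
Qed.

Lemma integral_prod_indic (B : nat -> set U) : (forall i, measurable (B i)) ->
  \int[P]_w (\prod_(i < k) \1_(B i) (X i w))%:E =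
  \prod_(i < k) \int[N i]_x (\1_(B i) x)%:E.
Proof.
move=> mB; under [RHS]eq_bigr do rewrite integral_indic// setIT.
rewrite -rectX//; set C := [set w | _].
have mC : measurable C.
  rewrite (_ : C = \bigcap_(i in [set i | (i < k)%N]) (X i @^-1` B i)).
    apply: bigcap_measurableType => i _.
    by rewrite -[_ @^-1` _]setTI; exact: mX.
  by apply/seteqP; split => w /=.
transitivity (\int[P]_w (\1_C w)%:E); last by rewrite integral_indic// setIT.
apply: eq_integral => w _; congr EFin; rewrite indicE.
case: (boolP (w \in C)) => /=.
  rewrite inE => Cw; rewrite big1// => i _; rewrite indicE mem_set//.
  by apply: Cw.
rewrite notin_setE => Cw; apply/eqP; rewrite prodf_seq_eq0.
have [i [ik Bi]] : exists i, (i < k)%N /\ ~ B i (X i w).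
  apply/not_existsP => nB; apply: Cw => i ik; apply: contrapT => nBi.
  by apply: (nB i).
apply/hasP; exists (Ordinal ik); rewrite ?mem_index_enum//=.
by rewrite indicE memNset.
Qed.

Lemma integral_indic_lty i (B : set U) : measurable B ->
  \int[N i]_x (\1_B x)%:E < +oo.
Proof.
move=> mB; rewrite integral_indic// setIT.
by apply: (le_lt_trans (probability_le1 (N i) mB)); rewrite ltry.
Qed.

(* The indicators of a rectangle are replaced by the [g i] one coordinate at a
   time: with the other coordinates frozen into a density, both sides are
   integrals of [g j] against proportional measures. *)
Lemma integral_prod (g : nat -> U -> R) : (forall i x, 0 <= g i x)%R ->
  (forall i, measurable_fun setT (g i)) ->
  (forall i, \int[N i]_x (g i x)%:E < +oo) ->
  \int[P]_w (\prod_(i < k) g i (X i w))%:E =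
  \prod_(i < k) \int[N i]_x (g i x)%:E.
Proof.
move=> g0 mg ig.
(* [j] counts the coordinates whose function is already arbitrary; from [j] on they are indicators.
   Coordinates from [k] on do not enter the products, so [g'] makes them the indicator of [setT] in
   order to apply the case [j = k]. *)
suff H j : forall g : nat -> U -> R, (forall i x, 0 <= g i x)%R ->
    (forall i, measurable_fun setT (g i)) ->
    (forall i, \int[N i]_x (g i x)%:E < +oo) ->
    (forall i, (j <= i)%N -> exists2 B, measurable B & g i = \1_B) ->
    \int[P]_w (\prod_(i < k) g i (X i w))%:E =
    \prod_(i < k) \int[N i]_x (g i x)%:E.
  pose g' i := if (i < k)%N then g i else \1_setT.
  transitivity (\int[P]_w (\prod_(i < k) g' i (X i w))%:E).
    by apply: eq_integral => w _; congr EFin; apply: eq_bigr => i _; rewrite /g' ltn_ord.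
  rewrite (H k g'); first by apply: eq_bigr => i _; rewrite /g' ltn_ord.
  - by move=> i x; rewrite /g'; case: ifP.
  - by move=> i; rewrite /g'; case: ifP => // _; exact: measurable_indic.
  - move=> i; rewrite /g'; case: ifP => // _.
    exact: integral_indic_lty.
  - move=> i ki; exists setT => //.
    by rewrite /g' ltnNge ki.
elim: j => [|j IH] {g g0 mg ig} g g0 mg ig gB.
  have {}gB i : {B | measurable B & g i = \1_B} by apply: cid2; exact: gB.
  pose B i := s2val (gB i).
  have gE i : g i = \1_(B i) by rewrite /B; case: (gB i).
  under eq_integral do under eq_bigr do rewrite gE.
  rewrite integral_prod_indic; last by move=> i; rewrite /B; case: (gB i).
  by apply: eq_bigr => i _; rewrite gE.
have [jk|kj] := ltnP j k; last first.
  pose g' i := if (i < k)%N then g i else \1_setT.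
  transitivity (\int[P]_w (\prod_(i < k) g' i (X i w))%:E).
    by apply: eq_integral => w _; congr EFin; apply: eq_bigr => i _; rewrite /g' ltn_ord.
  rewrite (IH g'); first by apply: eq_bigr => i _; rewrite /g' ltn_ord.
  - by move=> i x; rewrite /g'; case: ifP.
  - by move=> i; rewrite /g'; case: ifP => // _; exact: measurable_indic.
  - move=> i; rewrite /g'; case: ifP => // _.
    exact: integral_indic_lty.
  - move=> i ji; exists setT => //.
    by rewrite /g' ltnNge (leq_trans kj ji).
pose J := Ordinal jk.
pose h w := (\prod_(i < k | i != J) g i (X i w))%R.
have h0 w : (0 <= h w)%R by apply: prodr_ge0.
have mh : measurable_fun setT h.
  have -> : h = fun w => (\prod_(i < k) (if i != J then g i (X i w) else 1))%R.
    by apply/funext => w; rewrite /h big_mkcond.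
  apply: (@measurable_prod _ _ _ _ _ _
    (fun (i : 'I_k) w => if i != J then g i (X i w) else 1%R)) => i _.
  by case: (i != J) => //; exact: (measurableT_comp (mg i) (mX i)).
have [c c0 cE] : exists2 c : R, (0 <= c)%R &
    \prod_(i < k | i != J) \int[N i]_x (g i x)%:E = c%:E.
  apply: prod_ge0_fin => i _; rewrite ig andbT.
  by apply: integral_ge0 => x _; rewrite lee_fin.
transitivity (\int[P]_w (g j (X j w) * h w)%:E).
  by apply: eq_integral => w _; rewrite (bigD1 J).
rewrite (@density_pushforward _ _ _ P h h0 mh _ _ (X j) (N j) c)//; last first.
  (* Restricting coordinate [j] to [B] puts an indicator in place of [g j], so the induction
     hypothesis applies to [g']. *)
  move=> B mB; pose g' i := if i == j then \1_B else g i.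
  transitivity (\int[P]_w (\prod_(i < k) g' i (X i w))%:E).
    rewrite /density integral_mkcond; apply: eq_integral => w _.
    rewrite (bigD1 J)//= /g' eqxx patchE indicE.
    have -> : (w \in X j @^-1` B) = (X j w \in B) by apply/idP/idP; rewrite !inE.
    rewrite /h; case: ifP => _ /=; rewrite ?mul0r// mul1r.
    congr EFin; apply: eq_bigr => i; case: eqVneq => // /eqP iJ _.
    by case: eqVneq => // ij; exfalso; apply: iJ; exact: val_inj.
  rewrite IH.
  - rewrite (bigD1 J)//= {1}/g' eqxx integral_indic// setIT muleC -cE.
    congr (_ * _); apply: eq_bigr => i; case: eqVneq => // /eqP iJ _.
    by rewrite /g'; case: eqVneq => // ij; exfalso; apply: iJ; exact: val_inj.
  - by move=> i x; rewrite /g'; case: ifP.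
  - by move=> i; rewrite /g'; case: ifP => // _; exact: measurable_indic.
  - move=> i; rewrite /g'; case: ifP => // _.
    exact: integral_indic_lty.
  - move=> i; rewrite leq_eqVlt /g'; case: eqVneq => [->|ij].
      by move=> _; exists B.
    by move=> /gB.
by rewrite muleC -cE [RHS](bigD1 J).
Qed.

Lemma integral_marginal (i : nat) (f : U -> R) : (i < k)%N ->
  (forall x, 0 <= f x)%R -> measurable_fun setT f ->
  \int[N i]_x (f x)%:E < +oo ->
  \int[P]_w (f (X i w))%:E = \int[N i]_x (f x)%:E.
Proof.
move=> ik f0 mf foo; pose J := Ordinal ik.
pose g l := if l == i then f else cst 1%R.
have iN l : \int[N l]_x (cst 1%R x)%:E = 1.
  etransitivity; first exact: (integral_cst (N l) measurableT 1).
  by rewrite mul1e; exact: probability_setT.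
have gi : g i = f by rewrite /g eqxx.
have g1 (l : 'I_k) : l != J -> g l = cst 1%R.
  by move=> lJ; rewrite /g ifF//; apply/negbTE; rewrite -val_eqE in lJ.
have := @integral_prod g; rewrite (bigD1 J)//= gi.
rewrite [X in _ * X]big1 ?mule1; last by move=> l /g1 ->.
move=> <-.
- apply: eq_integral => w _; rewrite (bigD1 J)//= gi.
  by rewrite big1 ?mulr1// => l /g1 ->.
- by move=> l x; rewrite /g; case: ifP => //= _; exact: ler01.
- by move=> l; rewrite /g; case: ifP => // _; exact: measurable_cst.
- move=> l; rewrite /g; case: eqVneq => [->//|_].
  by rewrite iN ltry.
Qed.

Lemma integral_pair (i j : nat) (f h : U -> R) :
  (i < k)%N -> (j < k)%N -> i != j ->
  (forall x, 0 <= f x)%R -> measurable_fun setT f ->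
  (forall x, 0 <= h x)%R -> measurable_fun setT h ->
  \int[N i]_x (f x)%:E < +oo -> \int[N j]_x (h x)%:E < +oo ->
  \int[P]_w (f (X i w) * h (X j w))%:E =
  \int[N i]_x (f x)%:E * \int[N j]_x (h x)%:E.
Proof.
move=> ik jk ij f0 mf h0 mh foo hoo; pose I := Ordinal ik; pose J := Ordinal jk.
have JI : J != I by rewrite -val_eqE/= eq_sym.
pose g l := if l == i then f else if l == j then h else cst 1%R.
have iN l : \int[N l]_x (cst 1%R x)%:E = 1.
  etransitivity; first exact: (integral_cst (N l) measurableT 1).
  by rewrite mul1e; exact: probability_setT.
have g1 (l : 'I_k) : (l != I) && (l != J) -> g l = cst 1%R.
  move=> /andP[lI lJ]; rewrite /g ifF ?ifF//; apply/negbTE.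
    by rewrite -val_eqE in lJ.
  by rewrite -val_eqE in lI.
have gi : g i = f by rewrite /g eqxx.
have gj : g j = h by rewrite /g eq_sym (negbTE ij) eqxx.
have := @integral_prod g; rewrite (bigD1 I)//= (bigD1 J)//= gi gj.
rewrite [X in _ * (_ * X)]big1 ?mule1; last by move=> l /g1 ->.
move=> <-.
- apply: eq_integral => w _; rewrite (bigD1 I)//= (bigD1 J)//= gi gj.
  by rewrite big1 ?mulr1// => l /g1 ->.
- by move=> l x; rewrite /g; case: ifP => //= _; case: ifP => //= _; exact: ler01.
- by move=> l; rewrite /g; case: ifP => //= _; case: ifP => //= _; exact: measurable_cst.
- move=> l; rewrite /g; case: eqVneq => [->//|_]; case: eqVneq => [->//|_].
  by rewrite iN ltry.
Qed.

(** * Chebyshev's inequality for sums over independent coordinates *)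

Section chebyshev_sum.
Variables (g : nat -> U -> R) (M V : nat -> R).
Hypotheses (g0 : forall i x, (0 <= g i x)%R)
  (mg : forall i, measurable_fun setT (g i)).
Hypothesis gM : forall i, (i < k)%N -> \int[N i]_x (g i x)%:E = (M i)%:E.
Hypothesis gV : forall i, (i < k)%N ->
  \int[N i]_x (g i x ^+ 2)%:E = (M i ^+ 2 + V i)%:E.

Let S w := (\sum_(i < k) g i (X i w))%R.

Let mS : measurable_fun setT S.
Proof.
apply: (@measurable_sum _ _ _ _ _ _ (fun (i : 'I_k) w => g i (X i w))) => i.
exact: (measurableT_comp (mg i) (mX i)).
Qed.

Let S0 w : (0 <= S w)%R. Proof. by apply: sumr_ge0. Qed.

Let ES : 'E_P[S] = (\sum_(i < k) M i)%:E.
Proof.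
rewrite unlock; under eq_integral do rewrite /S -sumEFin.
rewrite ge0_integral_sum//=.
- rewrite -sumEFin; apply: eq_bigr => i _.
  by rewrite integral_marginal// gM// ltry.
- by move=> i; apply/measurable_EFinP; exact: (measurableT_comp (mg i) (mX i)).
- by move=> i w _; rewrite lee_fin.
Qed.

Let ES2 : \int[P]_w (S w ^+ 2)%:E =
  ((\sum_(i < k) M i) ^+ 2 + \sum_(i < k) V i)%:E.
Proof.
transitivity (\int[P]_w (\sum_(i < k) \sum_(j < k) (g i (X i w) * g j (X j w))%:E)).
  apply: eq_integral => w _; rewrite expr2 {1}/S mulr_suml -sumEFin.
  by apply: eq_bigr => i _; rewrite mulr_sumr -sumEFin.
have mgg (i j : 'I_k) : measurable_fun setT (fun w => (g i (X i w) * g j (X j w))%:E).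
  apply/measurable_EFinP; apply: measurable_funM.
  - exact: (measurableT_comp (mg i) (mX i)).
  - exact: (measurableT_comp (mg j) (mX j)).
rewrite ge0_integral_sum//=; last 2 first.
- by move=> i; apply: emeasurable_sum.
- by move=> i w _; apply: sume_ge0 => j _; rewrite lee_fin mulr_ge0.
transitivity (\sum_(i < k) (M i * (\sum_(j < k) M j) + V i)%:E); last first.
  rewrite sumEFin big_split/=; congr (_ + _)%:E.
  by rewrite expr2 mulr_suml.
apply: eq_bigr => i _; rewrite ge0_integral_sum//=; last first.
  by move=> j w _; rewrite lee_fin mulr_ge0.
rewrite (bigD1 i)//= [in RHS](bigD1 i)//=.
under eq_integral do rewrite -expr2.
rewrite (@integral_marginal i (fun x => g i x ^+ 2)%R)//; last 3 first.
- by move=> x; exact: sqr_ge0.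
- exact: measurable_funX.
- by rewrite gV// ltry.
rewrite gV// (eq_bigr (fun j : 'I_k => (M i * M j)%:E)); last first.
  move=> j ji; rewrite integral_pair// ?gM// ?ltry//.
  by rewrite eq_sym.
by rewrite sumEFin -EFinD mulrDr mulr_sumr expr2 addrAC.
Qed.

(** In the expanded square of the sum, off-diagonal terms integrate to [M i * M j] by independence
    and diagonal ones to [M i ^+ 2 + V i], so the variance is the sum of the [V i]. It serves twice:
    for the data, and for the posterior given the data. *)
Lemma chebyshev_sum (t : R) : (0 < t)%R ->
  P [set w | (t <= `|\sum_(i < k) g i (X i w) - \sum_(i < k) M i|)%R] <=
  ((\sum_(i < k) V i) / t ^+ 2)%:E.
Proof.
move=> t0.
pose S' : {RV P >-> R} := HB.pack S (isMeasurableFun.Build _ _ _ _ S mS).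
have S2 : (S : T -> R) \in Lfun P 2%:E.
  rewrite inE; apply/andP; split; rewrite inE//= /finite_norm unlock.
  under eq_integral do rewrite abse_EFin poweR_EFin powR_mulrn// real_normK ?num_real//.
  by rewrite ES2 poweR_EFin ltry.
have := @chebyshev _ _ _ P S' t t0; rewrite /= ES/= => /le_trans; apply.
rewrite varianceE// ES.
have -> : 'E_P[(S ^+ 2)%R] = \int[P]_w (S w ^+ 2)%:E by rewrite unlock.
by rewrite ES2 -EFin_expe -EFinB -EFinM lee_fin addrAC subrr add0r mulrC.
Qed.

End chebyshev_sum.
End independence.

(** * Moments of the normal distribution *)

Section gaussian_moments.
Context (R : realType).
Local Notation leb := (@lebesgue_measure R).
Local Notation N01 := (normal_prob (0 : R) 1).

Lemma integral_normal_prob (m s : R) (h : R -> R) :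
  (forall x, 0 <= h x) -> measurable_fun setT h ->
  (\int[normal_prob m s]_x (h x)%:E =
   \int[leb]_x (h x * normal_pdf m s x)%:E)%E.
Proof.
move=> h0 mh.
by rewrite -(integral_density leb (normal_pdf_ge0 m s) (measurable_normal_pdf m s)).
Qed.

(** A change of variance is an exponential tilt in [z ^+ 2]. Since the exponential dominates powers
    of [z], moments can be controlled from the total mass of centred normal laws alone. *)
Lemma normal_pdf_scale (s z : R) : 0 < s ->
  s * normal_pdf 0 s z = normal_pdf 0 1 z * expR ((1 - s ^- 2) / 2 * z ^+ 2).
Proof.
move=> s0; rewrite !normal_pdfE ?oner_neq0 ?gt_eqF// /normal_peak /normal_fun.
rewrite expr1n mul1r subr0.
have -> : Num.sqrt (s ^+ 2 * pi *+ 2) = s * Num.sqrt (pi *+ 2).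
  by rewrite -mulrnAr sqrtrM ?sqr_ge0// sqrtr_sqr gtr0_norm.
rewrite invfM !mulrA mulfV ?gt_eqF// mul1r -[RHS]mulrA -expRD; congr (_ * expR _).
by field; rewrite gt_eqF.
Qed.

Lemma normal_pdf_affine (m s z : R) : 0 < s ->
  normal_pdf m s (m + s * z) * s = normal_pdf 0 1 z.
Proof.
move=> s0; rewrite !normal_pdfE ?oner_neq0 ?gt_eqF// /normal_peak /normal_fun.
rewrite expr1n mul1r subr0.
have -> : Num.sqrt (s ^+ 2 * pi *+ 2) = s * Num.sqrt (pi *+ 2).
  by rewrite -mulrnAr sqrtrM ?sqr_ge0// sqrtr_sqr gtr0_norm.
rewrite mulrC mulrA invfM mulrA mulfV ?gt_eqF// mul1r; congr (_ * expR _).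
by field; rewrite gt_eqF.
Qed.

Lemma normal_prob_affine (m s : R) (h : R -> R) : 0 < s ->
  (forall x, 0 <= h x) -> continuous h ->
  (\int[normal_prob m s]_x (h x)%:E = \int[N01]_z (h (m + s * z))%:E)%E.
Proof.
move=> s0 h0 ch.
have mh : measurable_fun setT h by exact: continuous_measurable_fun.
pose F : R^o -> R^o := fun x => m + s * x.
have dF x : derivable F x 1.
  by apply: derivableD => //; exact: derivableM.
have F'E : F^`()%classic = cst s.
  apply/funext => x; rewrite /F derive1E deriveD// derive_cst add0r.
  by rewrite deriveM// derive_cst scaler0 addr0 derive_id scaler1.
have cF : continuous F.
  by move=> x; apply: cvgD; [exact: cvg_cst|apply: cvgM; [exact: cvg_cst|exact: cvg_id]].
rewrite integral_normal_prob// integral_normal_prob//; last first.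
  apply: measurableT_comp => //.
  exact: continuous_measurable_fun.
rewrite (@increasing_ge0_integration_by_substitutionT _ F).
- apply: eq_integral => z _; rewrite F'E /= !fctE/= /F.
  by rewrite -mulrA normal_pdf_affine.
- by move=> x y xy; rewrite /F ltrD2l ltr_pM2l.
- by rewrite F'E => ?; exact: cvg_cst.
- by rewrite F'E; exact: is_cvg_cst.
- by rewrite F'E; exact: is_cvg_cst.
- exact: dF.
- apply/cvgrNyPle => A; near=> x.
  by rewrite /F addrC -lerBrDr mulrC -ler_pdivlMr//; near: x; exact: nbhs_ninfty_le.
- apply/cvgryPge => A; near=> x.
  by rewrite /F addrC -lerBlDr mulrC -ler_pdivrMr//; near: x; exact: nbhs_pinfty_ge.
- move=> x; apply: cvgM; first exact: ch.
  by apply: continuous_normal_pdf; rewrite gt_eqF.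
- by move=> x; rewrite mulr_ge0// normal_pdf_ge0.
Unshelve. all: by end_near. Qed.

Lemma normal_prob_sym (h : R -> R) :
  (forall x, 0 <= h x) -> measurable_fun setT h ->
  (\int[N01]_z (h (- z))%:E = \int[N01]_z (h z)%:E)%E.
Proof.
move=> h0 mh.
have mhN : measurable_fun setT (fun z : R => h (- z)).
  by apply: measurableT_comp => //; exact: measurableT_comp.
rewrite !integral_normal_prob//.
have pN z : normal_pdf (0 : R) 1 z = normal_pdf 0 1 (- z).
  by rewrite !normal_pdfE ?oner_neq0// /normal_fun !subr0 sqrrN.
under eq_integral do rewrite pN.
pose f z := (h z * normal_pdf 0 1 z)%:E.
transitivity (\int[pushforward leb (-%R : _ -> measurableTypeR R)]_x f x)%E.
  rewrite ge0_integral_pushforward//.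
    apply/measurable_EFinP/measurable_funM => //; exact: measurable_normal_pdf.
  by move=> x _; rewrite lee_fin mulr_ge0// normal_pdf_ge0.
by apply: eq_measure_integral => A mA _; exact: lebesgue_measureN.
Qed.

(* Symmetrizing removes the odd moments, so that only integrals of nonnegative
   functions occur. *)
Lemma normal_prob_even (h : R -> R) (c : R) :
  (forall x, 0 <= h x) -> measurable_fun setT h ->
  (\int[N01]_z (h z + h (- z))%:E = (c *+ 2)%:E)%E ->
  (\int[N01]_z (h z)%:E = c%:E)%E.
Proof.
move=> h0 mh.
have mhN : measurable_fun setT (fun z : R => h (- z)).
  by apply: measurableT_comp => //; exact: measurableT_comp.
under eq_integral do rewrite EFinD.
rewrite ge0_integralD//=.
- rewrite normal_prob_sym//.
  have : (0 <= \int[N01]_z (h z)%:E)%E by apply: integral_ge0 => x _; rewrite lee_fin.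
  by case: (\int[N01]_z _)%E => //= r _ [] rr; congr EFin; lra.
- by move=> x _; rewrite lee_fin.
- exact/measurable_EFinP.
- by move=> x _; rewrite lee_fin.
- exact/measurable_EFinP.
Qed.

Let E2 := (\int[N01]_z (z ^+ 2)%:E)%E.

Let integral_pdfM (h : R -> R) (c : R) : 0 <= c ->
  (forall x, 0 <= h x) -> measurable_fun setT h ->
  (\int[leb]_z (c * (h z * normal_pdf 0 1 z))%:E =
   c%:E * \int[N01]_z (h z)%:E)%E.
Proof.
move=> c0 h0 mh; rewrite integral_normal_prob//.
under eq_integral do rewrite EFinM.
rewrite ge0_integralZl_EFin//.
- by move=> x _; rewrite lee_fin mulr_ge0// normal_pdf_ge0.
- apply/measurable_EFinP/measurable_funM => //; exact: measurable_normal_pdf.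
Qed.

Let msq : measurable_fun setT (fun z : R => z ^+ 2).
Proof. exact: measurable_funX. Qed.

Let mpdf (s : R) : measurable_fun setT (fun z => (s * normal_pdf 0 s z)%:E).
Proof.
apply/measurable_EFinP; apply: measurable_funM => //; exact: measurable_normal_pdf.
Qed.

Let mpdfsq (a : R) :
  measurable_fun setT (fun z : R => (a * (z ^+ 2 * normal_pdf 0 1 z))%:E).
Proof.
apply/measurable_EFinP; apply: measurable_funM => //; apply: measurable_funM => //.
exact: measurable_normal_pdf.
Qed.

Let integral_spdf (s : R) : 0 < s ->
  (\int[leb]_z (s * normal_pdf 0 s z)%:E = s%:E)%E.
Proof.
move=> s0; under eq_integral do rewrite EFinM.
rewrite ge0_integralZl_EFin ?ltW//.
- by rewrite integral_normal_pdf mule1.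
- by move=> x _; rewrite lee_fin normal_pdf_ge0.
- by apply/measurable_EFinP; exact: measurable_normal_pdf.
Qed.

(* [1 + u <= expR u] at [u = (1 - s ^- 2) / 2 * z ^+ 2] bounds the second moment
   from above for [s > 1] and from below for [s < 1], with equality as [s]
   tends to 1. *)
Lemma normal_sq_upper (s : R) : 1 < s ->
  (1 + ((1 - s ^- 2) / 2)%:E * E2 <= s%:E)%E.
Proof.
move=> s1; have s0 : 0 < s by apply: lt_trans s1.
have a0 : 0 <= (1 - s ^- 2) / 2.
  by rewrite divr_ge0// subr_ge0 invf_le1 ?exprn_gt0// exprn_ege1// ltW.
rewrite -integral_pdfM//; last by move=> x; exact: sqr_ge0.
rewrite -[X in (X + _)%E](@integral_spdf 1)// -ge0_integralD//=; last 4 first.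
- by move=> x _; rewrite lee_fin mul1r normal_pdf_ge0.
- exact: mpdf.
- by move=> x _; rewrite lee_fin mulr_ge0// mulr_ge0 ?sqr_ge0// normal_pdf_ge0.
- exact: mpdfsq.
rewrite -[leRHS]integral_spdf//; apply: ge0_le_integral => //.
- move=> x _; rewrite adde_ge0// lee_fin ?mul1r ?normal_pdf_ge0//.
  by rewrite mulr_ge0// mulr_ge0 ?sqr_ge0// normal_pdf_ge0.
- by apply: emeasurable_funD; [exact: mpdf|exact: mpdfsq].
- exact: mpdf.
move=> x _; rewrite -EFinD lee_fin (@normal_pdf_scale s)// mul1r.
have p0 := normal_pdf_ge0 (0 : R) 1 x.
set a := (_ / 2); have := ler_wpM2l p0 (expR_ge1Dx (a * x ^+ 2)).
lra.
Qed.

Lemma normal_sq_lower (s : R) : 0 < s -> s < 1 ->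
  (1 <= s%:E + ((s ^- 2 - 1) / 2)%:E * E2)%E.
Proof.
move=> s0 s1.
have a0 : 0 <= (s ^- 2 - 1) / 2.
  by rewrite divr_ge0// subr_ge0 invf_ge1 ?exprn_gt0// exprn_ile1// ltW.
rewrite -integral_pdfM//; last by move=> x; exact: sqr_ge0.
rewrite -[X in (X + _)%E](@integral_spdf s)// -ge0_integralD//=; last 4 first.
- by move=> x _; rewrite lee_fin; apply: mulr_ge0; [exact: ltW|exact: normal_pdf_ge0].
- exact: mpdf.
- by move=> x _; rewrite lee_fin mulr_ge0// mulr_ge0 ?sqr_ge0// normal_pdf_ge0.
- exact: mpdfsq.
rewrite -[leLHS](@integral_spdf 1)//; apply: ge0_le_integral => //.
- by move=> x _; rewrite lee_fin mul1r normal_pdf_ge0.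
- exact: mpdf.
- by apply: emeasurable_funD; [exact: mpdf|exact: mpdfsq].
move=> x _; rewrite -EFinD lee_fin (@normal_pdf_scale s)// mul1r.
have p0 := normal_pdf_ge0 (0 : R) 1 x.
have -> : (1 - s ^- 2) / 2 = - ((s ^- 2 - 1) / 2) by rewrite -mulNr opprB.
set a := (_ / 2); have := ler_wpM2l p0 (expR_ge1Dx (- a * x ^+ 2)).
lra.
Qed.

(** Multiplied by [s ^+ 2] and divided by the distance from [s] to 1, the two bounds become
    [(s + 1) * E2 <= 2 * s ^+ 2] for [1 < s] and the reverse for [s < 1]; together they pin the
    value at [s = 1]. *)
Lemma normal_second_moment : E2 = 1%E.
Proof.
have E0 : (0 <= E2)%E by apply: integral_ge0 => x _; rewrite lee_fin sqr_ge0.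
have up (s : R) : 1 < s -> ((s + 1)%:E * E2 <= (2 * s ^+ 2)%:E)%E.
  move=> s1; have s0 : 0 < s by apply: lt_trans s1.
  have := normal_sq_upper s1; case: E2 E0 => [r| |]//= r0.
    rewrite -EFinM -EFinD !lee_fin => h.
    have : (s - 1) * ((s + 1) * r) <= (s - 1) * (2 * s ^+ 2).
      have s2 : 0 < s ^+ 2 by rewrite exprn_gt0.
      have := ler_wpM2r (ltW s2) h; rewrite mulrDl.
      have -> : (1 - s ^- 2) / 2 * r * s ^+ 2 = (s ^+ 2 - 1) / 2 * r.
        by field; rewrite gt_eqF.
      nra.
    by rewrite ler_pM2l// subr_gt0.
  rewrite gt0_muley//.
  by rewrite lte_fin divr_gt0// subr_gt0 invf_lt1 ?exprn_gt0// exprn_egt1.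
have lo (s : R) : 0 < s -> s < 1 -> ((2 * s ^+ 2)%:E <= (s + 1)%:E * E2)%E.
  move=> s0 s1.
  have := normal_sq_lower s0 s1; case: E2 E0 => [r| |]//= r0; last first.
    by move=> _; rewrite gt0_muley ?leey// lte_fin addr_gt0.
  rewrite -EFinM -EFinD !lee_fin => h.
  have : (1 - s) * (2 * s ^+ 2) <= (1 - s) * ((s + 1) * r).
    have s2 : 0 < s ^+ 2 by rewrite exprn_gt0.
    have := ler_wpM2r (ltW s2) h; rewrite mulrDl.
    have -> : (s ^- 2 - 1) / 2 * r * s ^+ 2 = (1 - s ^+ 2) / 2 * r.
      by field; rewrite gt_eqF.
    nra.
  by rewrite ler_pM2l// subr_gt0.
case: E2 E0 up lo => [r| |]//= r0 up lo; last first.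
  have /up : 1 < 2 :> R by rewrite ltr1n.
  by rewrite gt0_muley// lte_fin.
congr EFin; apply/eqP; rewrite eq_le; apply/andP; split; rewrite leNgt; apply/negP => h.
  (* The midpoint of 1 and [r] replaces a limit: there [(s + 1) * r = 2 * s ^+ 2 + (s - 1)], which
     violates the bound on the corresponding side of 1. *)
  pose s := (1 + r) / 2; have s1 : 1 < s by rewrite /s; lra.
  have rE : r = 2 * s - 1 by rewrite /s; lra.
  have := up _ s1; rewrite -EFinM lee_fin rE; nra.
pose s := (1 + r) / 2; have s1 : s < 1 by rewrite /s; lra.
have s0 : 0 < s by move: r0; rewrite lee_fin /s => r0; lra.
have rE : r = 2 * s - 1 by rewrite /s; lra.
have := lo _ s0 s1; rewrite -EFinM lee_fin rE; nra.
Qed.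

Lemma normal_fourth_moment_lty : (\int[N01]_z (z ^+ 4)%:E < +oo)%E.
Proof.
have m4 : measurable_fun setT (fun z : R => z ^+ 4) by exact: measurable_funX.
rewrite integral_normal_prob//; last by move=> x; rewrite exprn_even_ge0.
(* For standard deviation 2 the tilt is [expR (3 / 8 * z ^+ 2)]. Squaring [u <= expR u] at
   [u = 3 / 16 * z ^+ 2] bounds [z ^+ 4] by [(16 / 3) ^+ 2 = 256 / 9] times this tilt. *)
apply: (@le_lt_trans _ _ (\int[leb]_z ((256 / 9)%:E * (2 * normal_pdf 0 2 z)%:E))%E).
  apply: ge0_le_integral => //.
  - by move=> x _; rewrite lee_fin mulr_ge0 ?exprn_even_ge0// normal_pdf_ge0.
  - by apply/measurable_EFinP/measurable_funM => //; exact: measurable_normal_pdf.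
  - by apply: measurable_funeM; exact: mpdf.
  move=> x _; rewrite -EFinM lee_fin (@normal_pdf_scale 2)// mulrCA mulrC.
  rewrite ler_wpM2l ?normal_pdf_ge0//.
  have -> : (1 - 2 ^- 2) / 2 * x ^+ 2 = (3 / 16 * x ^+ 2) *+ 2 :> R by field.
  rewrite mulr2n expRD -expr2.
  have x2 : 0 <= 3 / 16 * x ^+ 2 by rewrite mulr_ge0 ?sqr_ge0//; lra.
  have h : 3 / 16 * x ^+ 2 <= expR (3 / 16 * x ^+ 2).
    by apply: le_trans (expR_ge1Dx _); lra.
  have : (3 / 16 * x ^+ 2) ^+ 2 <= expR (3 / 16 * x ^+ 2) ^+ 2.
    by rewrite lerXn2r// nnegrE expR_ge0.
  lra.
rewrite ge0_integralZl_EFin//.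
- by rewrite integral_spdf// -EFinM ltry.
- by move=> x _; rewrite lee_fin mulr_ge0// normal_pdf_ge0.
- exact: mpdf.
Qed.

(* Its value is 3, but only finiteness matters here. *)
Definition normal_fourth_moment : R := fine (\int[N01]_z (z ^+ 4)%:E)%E.

Lemma integral_normal_even_poly (a b c : R) : 0 <= a -> 0 <= b -> 0 <= c ->
  (\int[N01]_z (a + b * z ^+ 2 + c * z ^+ 4)%:E =
   (a + b + c * normal_fourth_moment)%:E)%E.
Proof.
move=> a0 b0 c0.
have m4 : measurable_fun setT (fun z : R => z ^+ 4) by exact: measurable_funX.
have x4 (x : R) : 0 <= x ^+ 4 by rewrite exprn_even_ge0.
transitivity (\int[N01]_z (a%:E + b%:E * (z ^+ 2)%:E + c%:E * (z ^+ 4)%:E))%E.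
  by apply: eq_integral => z _; rewrite -!EFinM -!EFinD.
rewrite ge0_integralD//=; last 4 first.
- by move=> x _; rewrite -EFinM -EFinD lee_fin addr_ge0// mulr_ge0// sqr_ge0.
- by apply: emeasurable_funD => //; apply/measurable_funeM/measurable_EFinP.
- by move=> x _; rewrite -EFinM lee_fin mulr_ge0.
- by apply/measurable_funeM/measurable_EFinP.
rewrite ge0_integralD//=; last 2 first.
- by move=> x _; rewrite -EFinM lee_fin mulr_ge0// sqr_ge0.
- by apply/measurable_funeM/measurable_EFinP.
rewrite ge0_integralZl_EFin//=; last 2 first.
- by move=> x _; rewrite lee_fin sqr_ge0.
- exact/measurable_EFinP.
rewrite ge0_integralZl_EFin//=; last 2 first.
- by move=> x _; rewrite lee_fin.
- exact/measurable_EFinP.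
have -> : (\int[N01]_z a%:E = a%:E)%E.
  rewrite integral_cst//= [X in (_ * X)%E](_ : _ = 1%E) ?mule1//.
  exact: probability_setT.
have -> : (\int[N01]_z (z ^+ 4)%:E = normal_fourth_moment%:E)%E.
  rewrite fineK// ge0_fin_numE ?normal_fourth_moment_lty//.
  by apply: integral_ge0 => x _; rewrite lee_fin.
by rewrite -/E2 normal_second_moment mule1 -EFinM -!EFinD.
Qed.

(** Odd powers of [z] cancel after symmetrization. The excess over the squared mean in the second
    identity is the variance of the square, the familiar [4 * m ^+ 2 * s ^+ 2 + 2 * s ^+ 4] once the
    fourth moment is 3. *)
Lemma normal_sq_moments (m s : R) :
  (\int[N01]_z ((m + s * z) ^+ 2)%:E = (m ^+ 2 + s ^+ 2)%:E)%E /\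
  (\int[N01]_z (((m + s * z) ^+ 2) ^+ 2)%:E =
   ((m ^+ 2 + s ^+ 2) ^+ 2 +
    (4 * m ^+ 2 * s ^+ 2 + (normal_fourth_moment - 1) * s ^+ 4))%:E)%E.
Proof.
have mlin : measurable_fun setT (fun z : R => m + s * z).
  by apply: measurable_funD => //; exact: measurable_funM.
split; apply: normal_prob_even.
- by move=> x; exact: sqr_ge0.
- exact: measurable_funX.
- transitivity (\int[N01]_z (2 * m ^+ 2 + 2 * s ^+ 2 * z ^+ 2 + 0 * z ^+ 4)%:E)%E.
    by apply: eq_integral => z _; congr EFin; ring.
  rewrite integral_normal_even_poly; [|by rewrite mulr_ge0 ?sqr_ge0..|by []].
  by congr EFin; ring.
- by move=> x; exact: sqr_ge0.
- by apply: measurable_funX; exact: measurable_funX.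
- transitivity (\int[N01]_z (2 * m ^+ 4 + 12 * m ^+ 2 * s ^+ 2 * z ^+ 2 +
      2 * s ^+ 4 * z ^+ 4)%:E)%E.
    by apply: eq_integral => z _; congr EFin; ring.
  have m4 : 0 <= m ^+ 4 by rewrite exprn_even_ge0.
  have s4 : 0 <= s ^+ 4 by rewrite exprn_even_ge0.
  have m2 := sqr_ge0 m; have s2 := sqr_ge0 s.
  rewrite integral_normal_even_poly; [|exact: mulr_ge0| |exact: mulr_ge0].
    by congr EFin; ring.
  by rewrite mulr_ge0// mulr_ge0.
Qed.

End gaussian_moments.

(** * The posterior distribution *)

Section seqspace.
Context (R : realType).

Lemma measurable_coord (i : nat) :
  measurable_fun setT (fun f : seqspace R => (f : nat -> R) i).
Proof.
move=> _ B mB; rewrite setTI; apply: sub_sigma_algebra.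
by exists i, B.
Qed.

Lemma l2norm_le (f : nat -> R) (t : R) : 0 <= t ->
  (l2norm f <= t%:E)%E = (\sum_(0 <= i <oo) ((f i) ^+ 2)%:E <= (t ^+ 2)%:E)%E.
Proof.
move=> t0; rewrite /l2norm.
have S0 : (0 <= \sum_(0 <= i <oo) ((f i) ^+ 2)%:E)%E.
  by apply: nneseries_ge0 => i _ _; rewrite lee_fin sqr_ge0.
by rewrite -lee_sqr ?sqrte_ge0 ?lee_fin// sqr_sqrte.
Qed.

Lemma l2norm_gt (f : nat -> R) (t : R) : 0 <= t ->
  (t%:E < l2norm f)%E = ((t ^+ 2)%:E < \sum_(0 <= i <oo) ((f i) ^+ 2)%:E)%E.
Proof. by move=> t0; rewrite !ltNge l2norm_le. Qed.

Lemma measurable_l2ball (t : R) : 0 <= t ->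
  measurable [set f : seqspace R | (l2norm f <= t%:E)%E].
Proof.
move=> t0.
rewrite (_ : mkset _ = setT `&` [set f : seqspace R |
   (\sum_(0 <= i <oo) (((f : nat -> R) i) ^+ 2)%:E <= (t ^+ 2)%:E)%E]).
  apply: emeasurable_fun_infty_c => //.
  apply: (@ge0_emeasurable_sum _ _ _ _
    (fun i (f : seqspace R) => (((f : nat -> R) i) ^+ 2)%:E) xpredT).
    by move=> i f _ _; rewrite lee_fin sqr_ge0.
  move=> i _; apply/measurable_EFinP; apply: measurable_funX.
  exact: measurable_coord.
by rewrite setTI; apply/seteqP; split => f /=; rewrite l2norm_le.
Qed.

Lemma nneseries_finite_support (u : nat -> R) (k : nat) :
  (forall i, (k <= i)%N -> u i = 0) ->
  (\sum_(0 <= i <oo) (u i)%:E = (\sum_(i < k) u i)%:E)%E.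
Proof.
move=> u0; apply: lim_near_cst => //; near=> N.
have kN : (k <= N)%N by near: N; exact: nbhs_infty_ge.
rewrite (big_cat_nat _ kN)//= [X in (_ + X)%E]big1_seq ?adde0; last first.
  by move=> i; rewrite mem_index_iota => /andP[_ /andP[ki _]]; rewrite u0.
by rewrite big_mkord sumEFin.
Unshelve. all: by end_near. Qed.

End seqspace.

Section gaussian_posterior.
Context (R : realType) (n k : nat) (prec : nat -> R) (y : nat -> R).
Variable Pi : probability (seqspace R) R.
Hypotheses (n0 : (0 < n)%N) (prec0 : forall i, 0 < prec i).
Hypothesis hPi : truncated_gaussian_prior k prec Pi.

Let w i (x : R) : R := normal_pdf x (Num.sqrt n%:R)^-1 (y i) /
                    normal_pdf 0 (Num.sqrt n%:R)^-1 (y i).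
Let N i : probability _ R := normal_prob 0 (Num.sqrt (prec i)^-1).
Let mu i : R := n%:R / (n%:R + prec i) * y i.
Let sigma i : R := Num.sqrt (n%:R + prec i)^-1.
Let Q i : probability _ R := normal_prob (mu i) (sigma i).

Let nR : 0 < n%:R :> R. Proof. by rewrite ltr0n. Qed.

Let snN0 : (Num.sqrt n%:R)^-1 != 0 :> R.
Proof. by rewrite invr_eq0 gt_eqF// sqrtr_gt0. Qed.

Let sigma0 i : 0 < sigma i.
Proof. by rewrite sqrtr_gt0 invr_gt0 addr_gt0. Qed.

Let wE i x : w i x = expR (n%:R * x * y i - n%:R * x ^+ 2 / 2).
Proof.
rewrite /w !normal_pdfE//.
have pk : normal_peak (Num.sqrt n%:R)^-1 != 0 :> R.
  by rewrite gt_eqF// normal_peak_gt0.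
rewrite -mulf_div divff// mul1r /normal_fun -expRN -expRD; congr expR.
rewrite exprVn sqr_sqrtr ?ltW// subr0.
by field; rewrite gt_eqF.
Qed.

Let w0 i x : 0 <= w i x. Proof. by rewrite wE expR_ge0. Qed.

Let mw i : measurable_fun setT (w i).
Proof.
rewrite (_ : w i = fun x => expR (n%:R * x * y i - n%:R * x ^+ 2 / 2)); last first.
  by apply/funext => x; rewrite wE.
apply: measurableT_comp => //; apply: measurable_funB.
  by apply: measurable_funM => //; apply: measurable_funM.
by apply: measurable_funM => //; apply: measurable_funM.
Qed.

(** Conjugacy, by completing the square in [x]. The constant combines the ratio of the two
    normalizations with the exponential of the maximum of the quadratic exponent; it is the evidence
    of coordinate [i] relative to the zero signal. *)
Let w_posterior i : exists2 c : R, 0 < c & forall x,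
  w i x * normal_pdf 0 (Num.sqrt (prec i)^-1) x =
  c * normal_pdf (mu i) (sigma i) x.
Proof.
have s0 := prec0 i; have ns0 : 0 < n%:R + prec i by rewrite addr_gt0.
have p0 : Num.sqrt (prec i)^-1 != 0 by rewrite gt_eqF// sqrtr_gt0 invr_gt0.
have q0 : sigma i != 0 by rewrite gt_eqF.
exists (normal_peak (Num.sqrt (prec i)^-1) / normal_peak (sigma i) *
        expR ((n%:R * y i) ^+ 2 / (2 * (n%:R + prec i)))).
  by rewrite mulr_gt0 ?expR_gt0// divr_gt0// normal_peak_gt0.
move=> x; rewrite !normal_pdfE// wE.
have pk : normal_peak (sigma i) != 0 by rewrite gt_eqF// normal_peak_gt0.
have aux (p q a b e d : R) : q != 0 -> a * b = e * d ->
    a * (p * b) = p / q * e * (q * d).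
  by move=> q00 abed; rewrite mulrCA abed; field.
apply: aux => //; rewrite /normal_fun -!expRD; congr expR.
rewrite /mu /sigma !sqr_sqrtr ?invr_ge0 ?ltW//.
by field; rewrite !gt_eqF.
Qed.

Let c i := s2val (cid2 (w_posterior i)).

Let c0 i : 0 < c i. Proof. by rewrite /c; case: cid2. Qed.

Let cE i x : w i x * normal_pdf 0 (Num.sqrt (prec i)^-1) x =
  c i * normal_pdf (mu i) (sigma i) x.
Proof. by rewrite /c; case: cid2. Qed.

Let integral_w i (B : set R) : measurable B ->
  (\int[N i]_x (\1_B x * (w i x / c i))%:E = Q i B)%E.
Proof.
move=> mB; rewrite integral_normal_prob.
- rewrite /Q/= /normal_prob [RHS]integral_mkcond; apply: eq_integral => x _.
  rewrite patchE indicE; case: ifP => _; last by rewrite !mul0r.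
  by rewrite mul1r mulrAC cE mulrAC divff ?gt_eqF// mul1r.
- by move=> x; rewrite mulr_ge0// divr_ge0// ltW.
- by apply: measurable_funM => //; exact: measurable_funM.
Qed.

(** Density of the posterior with respect to the prior, normalized coordinate by coordinate so that
    each factor has prior integral 1. *)
Let h (f : seqspace R) : R := \prod_(i < k) (w i ((f : nat -> R) i) / c i).

Let h0 f : 0 <= h f.
Proof. by apply: prodr_ge0 => i _; rewrite divr_ge0// ltW. Qed.

Let mh : measurable_fun setT h.
Proof.
apply: (@measurable_prod _ _ _ _ _ _
  (fun (i : 'I_k) (f : seqspace R) => w i ((f : nat -> R) i) / c i)) => i _.
apply: measurable_funM => //.
exact: (measurableT_comp (mw i) (measurable_coord _)).
Qed.

Let Z : R := \prod_(i < k) c i.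

Let Z0 : 0 < Z. Proof. by apply: prodr_gt0. Qed.

Let supp : set (seqspace R) := [set f | forall i, (k <= i)%N -> f i = 0].

Let msupp : measurable supp.
Proof.
rewrite (_ : supp = \bigcap_(i in [set i | (k <= i)%N])
    ((fun f : seqspace R => (f : nat -> R) i) @^-1` [set 0])).
  apply: bigcap_measurableType => i _.
  by rewrite -[X in measurable X]setTI; exact: measurable_coord.
by apply/seteqP; split => f /=.
Qed.

Let likelihoodE f : supp f -> likelihood n f y = (Z * h f)%:E.
Proof.
move=> sf; apply: (cvg_limn_einf_sup _).2; apply: cvg_near_cst; near=> M.
have kM : (k <= M)%N by near: M; exact: nbhs_infty_ge.
congr EFin; rewrite -(big_mkord xpredT (fun i => w i (f i))).
rewrite (big_cat_nat _ kM)//= [X in _ * X]big1_seq ?mulr1; last first.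
  move=> i; rewrite mem_index_iota => /andP[_ /andP[ki _]].
  by rewrite sf// wE !mulr0 mul0r expr0n/= mulr0 mul0r subr0 expR0.
rewrite big_mkord /Z /h -big_split/=; apply: eq_bigr => i _.
by rewrite mulrC divfK// gt_eqF.
Unshelve. all: by end_near. Qed.

Let likelihood_ge0 f : (0 <= likelihood n f y)%E.
Proof.
rewrite /likelihood limn_esup_lim; apply: lime_ge; first exact: is_cvg_esups.
apply: nearW => M; apply: (@le_trans _ _ (\prod_(i < M) w i (f i))%:E).
  by rewrite lee_fin prodr_ge0.
by rewrite /esups/=; apply: ereal_sup_ubound; exists M => //=.
Qed.

Let mlikelihood : measurable_fun setT (fun f : seqspace R => likelihood n f y).
Proof.
apply: measurable_fun_limn_esup => M; apply/measurable_EFinP.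
apply: (@measurable_prod _ _ _ _ _ _
  (fun (i : 'I_M) (f : seqspace R) => w i ((f : nat -> R) i))) => i _.
exact: (measurableT_comp (mw i) (measurable_coord _)).
Qed.

(** On [supp], which has prior probability 1, the likelihood is the finite product [Z * h];
    elsewhere it is only an upper limit. Hence only the trace of a set on [supp] counts, which lets
    an l^2 ball be exchanged for a condition on the first [k] coordinates. *)
Let integral_likelihood (A B : set (seqspace R)) :
  measurable A -> measurable B -> A `&` supp = B `&` supp ->
  (\int[Pi]_(f in A) likelihood n f y = Z%:E * density Pi h0 mh B)%E.
Proof.
move=> mA mB AB.
rewrite /density [LHS]integral_mkcond [in RHS]integral_mkcond.
rewrite -ge0_integralZl_EFin ?ltW//; last 2 first.
- move=> f _; rewrite patchE; case: ifP => //; by rewrite lee_fin.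
- apply/(measurable_restrictT _ _).1 => //.
  by apply: measurable_funTS; exact/measurable_EFinP.
apply: ge0_ae_eq_integral => //.
- apply/(measurable_restrictT _ _).1 => //; exact: measurable_funTS.
- apply: measurable_funeM; apply/(measurable_restrictT _ _).1 => //.
  by apply: measurable_funTS; exact/measurable_EFinP.
- by move=> f _; rewrite patchE; case: ifP => _; rewrite ?likelihood_ge0.
- move=> f _; apply: mule_ge0; first by rewrite lee_fin ltW.
  by rewrite patchE; case: ifP => _; rewrite ?lee_fin.
exists (~` supp); split; first exact: measurableC.
  have := probability_setC Pi msupp; rewrite [X in (1 - X)%E]hPi.2 subee//.
move=> f /= H sf; apply: H => _.
rewrite !patchE likelihoodE//.
have -> : (f \in A) = (f \in B).
  have : (A `&` supp) f <-> (B `&` supp) f by rewrite AB.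
  move=> [H1 H2]; apply/idP/idP; rewrite !inE => H.
    by apply: (H1 _).1.
  by apply: (H2 _).1.
by case: ifP => _; rewrite ?mule0// EFinM.
Qed.

(** Each factor of [h] turns the prior law of its coordinate into the conjugate normal law, so
    [density Pi h0 mh] has product values on rectangles and total mass 1. In Bayes' formula the
    evidence [Z] cancels; it is finite and positive, so the [fine] values and the quotient are
    genuine. *)
Lemma posterior_normal : exists Pp : probability (seqspace R) R,
  (forall B : nat -> set R, (forall i, measurable (B i)) ->
    Pp [set f | forall i, (i < k)%N -> B i (f i)] =
    (\prod_(i < k) normal_prob (n%:R / (n%:R + prec i) * y i)
      (Num.sqrt (n%:R + prec i)^-1) (B i))%E) /\
  (forall t : R, 0 <= t ->
    posterior Pi n y [set f | (l2norm f <= t%:E)%E] =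
    fine (Pp [set f : seqspace R | \sum_(i < k) (f : nat -> R) i ^+ 2 <= t ^+ 2])).
Proof.
have rect (B : nat -> set R) : (forall i, measurable (B i)) ->
    (density Pi h0 mh [set f | forall i, (i < k)%N -> B i (f i)] =
     \prod_(i < k) Q i (B i))%E.
  move=> mB; rewrite /density integral_mkcond.
  transitivity (\int[Pi]_f (\prod_(i < k)
      (\1_(B i) ((f : nat -> R) i) * (w i ((f : nat -> R) i) / c i)))%:E)%E.
    apply: eq_integral => f _; rewrite patchE; case: ifPn.
      rewrite inE/= => Bf; congr EFin; apply: eq_bigr => i _.
      by rewrite indicE mem_set ?mul1r//; apply: Bf.
    rewrite notin_setE/= => Bf.
    have [i [ik Bi]] : exists i, (i < k)%N /\ ~ B i (f i).
      apply/not_existsP => nB; apply: Bf => i ik; apply: contrapT => nBi.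
      by apply: (nB i).
    by rewrite (bigD1 (Ordinal ik))//= indicE memNset// !mul0r.
  have mg i : measurable_fun setT (fun x : R => \1_(B i) x * (w i x / c i)).
    by apply: measurable_funM => //; exact: measurable_funM.
  have := @integral_prod _ _ (seqspace R) (measurableTypeR R) R Pi k
    (fun i (f : seqspace R) => (f : nat -> R) i) N
    (@measurable_coord R) hPi.1 (fun i x => \1_(B i) x * (w i x / c i)).
  rewrite /= => ->.
  - by apply: eq_bigr => i _; exact: integral_w.
  - by move=> i x; rewrite mulr_ge0// divr_ge0// ltW.
  - exact: mg.
  - move=> i; apply: (@le_lt_trans _ _ (Q i (B i))); first by rewrite -integral_w.
    by apply: (le_lt_trans (probability_le1 (Q i) (mB i))); rewrite ltry.
have DT : (density Pi h0 mh setT = 1)%E.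
  rewrite (_ : setT = [set f | forall i, (i < k)%N -> setT (f i)]); last first.
    by apply/seteqP; split.
  rewrite (rect (fun=> setT))// big1// => i _; exact: probability_setT.
pose D : probability (seqspace R) R := HB.pack (density Pi h0 mh)
  (@Measure_isProbability.Build _ _ R (density Pi h0 mh) DT).
exists D; split; first exact: rect.
move=> t t0.
pose S (f : seqspace R) : R := \sum_(i < k) (f : nat -> R) i ^+ 2.
have mS : measurable_fun setT (fun f => (S f)%:E).
  apply/measurable_EFinP; apply: (@measurable_sum _ _ _ _ _ _
    (fun (i : 'I_k) (f : seqspace R) => (f : nat -> R) i ^+ 2)) => i.
  by apply: measurable_funX; exact: measurable_coord.
have mB : measurable [set f : seqspace R | S f <= t ^+ 2].
  rewrite (_ : mkset _ = setT `&` [set f | ((S f)%:E <= (t ^+ 2)%:E)%E]).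
    exact: emeasurable_fun_infty_c.
  by rewrite setTI; apply/seteqP; split => f /=; rewrite lee_fin.
rewrite /posterior (integral_likelihood _ mB).
- rewrite (integral_likelihood measurableT measurableT)// DT mule1/=.
  have : (density Pi h0 mh [set f | S f <= t ^+ 2]%R <= 1)%E.
    exact: (probability_le1 D mB).
  have : (0 <= density Pi h0 mh [set f | S f <= t ^+ 2]%R)%E by [].
  by case: density => //= r _ _; rewrite mulrAC divff ?mul1r// gt_eqF.
- exact: measurable_l2ball.
- apply/seteqP; split => f [/= H sf]; split => //=; move: H.
    rewrite l2norm_le// (@nneseries_finite_support _ (fun i => f i ^+ 2) k) ?lee_fin//.
    by move=> i ki; rewrite sf// expr0n.
  move=> Sf.
  rewrite l2norm_le// (@nneseries_finite_support _ (fun i => f i ^+ 2) k) ?lee_fin//.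
  by move=> i ki; rewrite sf// expr0n.
Qed.

End gaussian_posterior.

(** * Concentration of the squared norm *)

(** The integral of a nonnegative function is a supremum over the simple functions below it, hence
    monotone even when [X] is not measurable. This avoids having to prove that the posterior depends
    measurably on the data. *)
Lemma expectation_le_prob d (T : measurableType d) (R : realType)
    (P : probability T R) (X : T -> R) (B : set T) : measurable B ->
  (forall w, 0 <= X w <= \1_B w) -> ('E_P[X] <= P B)%E.
Proof.
move=> mB XB; rewrite unlock.
have -> : P B = (\int[P]_w (\1_B w)%:E)%E by rewrite integral_indic// setIT.
rewrite !ge0_integralTE//; last by move=> w; rewrite lee_fin; case/andP: (XB w).
apply: le_ereal_sup => _ [h hX <-]; exists h => // w.
by apply: le_trans (hX w) _; rewrite lee_fin; case/andP: (XB w).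
Qed.

Section chebyshev.
Context (R : realType).
Local Notation K := (normal_fourth_moment R).

Lemma normal_fourth_moment_ge0 : 0 <= K.
Proof.
apply: fine_ge0; apply: integral_ge0 => x _; by rewrite lee_fin exprn_even_ge0.
Qed.

Lemma normal_prob_sq_moments (m s : R) : 0 < s ->
  (\int[normal_prob m s]_x (x ^+ 2)%:E = (m ^+ 2 + s ^+ 2)%:E)%E /\
  (\int[normal_prob m s]_x ((x ^+ 2) ^+ 2)%:E =
   ((m ^+ 2 + s ^+ 2) ^+ 2 + (4 * m ^+ 2 * s ^+ 2 + (K - 1) * s ^+ 4))%:E)%E.
Proof.
move=> s0; have [h1 h2] := normal_sq_moments m s.
split; rewrite normal_prob_affine//.
- by move=> x; exact: sqr_ge0.
- exact: exprn_continuous.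
- by move=> x; exact: sqr_ge0.
- move=> x; apply: (@continuous_comp _ _ _ (fun z : R => z ^+ 2) (fun z : R => z ^+ 2));
    exact: exprn_continuous.
Qed.

(** [M] is the posterior mean of the squared norm and [V] bounds its posterior variance, using
    [1 / (n + prec i) <= 1 / n] and [K - 1 <= K]. As [V] depends on the data through [S], the bounds
    become effective once [S] is controlled. *)
Lemma posterior_chebyshev (n k : nat) (prec y : nat -> R)
    (Pi : probability (seqspace R) R) (t tau : R) :
  (0 < n)%N -> (forall i, 0 < prec i) -> truncated_gaussian_prior k prec Pi ->
  0 < t -> 0 <= tau ->
  let S := \sum_(i < k) (n%:R / (n%:R + prec i) * y i) ^+ 2 in
  let M := S + \sum_(i < k) (n%:R + prec i)^-1 in
  let V := 4 * S / n%:R + K * (k%:R / n%:R ^+ 2) in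
  let p := posterior Pi n y [set f | (l2norm f <= tau%:E)%E] in
  (M + t <= tau ^+ 2 -> 1 - V / t ^+ 2 <= p) /\
  (tau ^+ 2 + t <= M -> p <= V / t ^+ 2).
Proof.
move=> n0 prec0 hPi t0 tau0 S M V p.
have nR : 0 < n%:R :> R by rewrite ltr0n.
have [Q [rectQ pE]] := @posterior_normal _ n k prec y Pi n0 prec0 hPi.
rewrite /p pE//.
pose mu i := n%:R / (n%:R + prec i) * y i.
pose s i := Num.sqrt (n%:R + prec i)^-1.
have ns i : 0 < n%:R + prec i by rewrite addr_gt0.
have s0 i : 0 < s i by rewrite sqrtr_gt0 invr_gt0.
have s2 i : s i ^+ 2 = (n%:R + prec i)^-1 by rewrite sqr_sqrtr// invr_ge0 ltW.
pose v i := 4 * mu i ^+ 2 * s i ^+ 2 + (K - 1) * s i ^+ 4.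
have cheb := @chebyshev_sum _ _ (seqspace R) (measurableTypeR R) R Q k
  (fun i (f : seqspace R) => (f : nat -> R) i)
  (fun i => normal_prob (mu i) (s i)) (@measurable_coord R) rectQ
  (fun _ x => x ^+ 2) (fun i => mu i ^+ 2 + s i ^+ 2) v
  (fun _ x => sqr_ge0 x) (fun _ => measurable_funX 2 (@measurable_id _ _ setT))
  (fun i _ => (normal_prob_sq_moments (mu i) (s0 i)).1)
  (fun i _ => (normal_prob_sq_moments (mu i) (s0 i)).2) t t0.
have ME : \sum_(i < k) (mu i ^+ 2 + s i ^+ 2) = M.
  by rewrite big_split/=; congr (_ + _); apply: eq_bigr => i _; rewrite s2.
rewrite ME in cheb.
have vV : (\sum_(i < k) v i) / t ^+ 2 <= V / t ^+ 2.
  rewrite ler_pM2r ?invr_gt0 ?exprn_gt0//.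
  have -> : V = \sum_(i < k) (4 * mu i ^+ 2 / n%:R + K / n%:R ^+ 2).
    rewrite big_split/= -mulr_suml -mulr_sumr sumr_const card_ord /V -/S.
    by congr (_ + _); rewrite -mulr_natl; ring.
  apply: ler_sum => i _; rewrite /v; have K0 := normal_fourth_moment_ge0.
  have sn : s i ^+ 2 <= n%:R^-1 by rewrite s2 lef_pV2 ?posrE// lerDl ltW.
  apply: lerD; first by rewrite ler_wpM2l// mulr_ge0// sqr_ge0.
  have s4 : s i ^+ 4 <= n%:R ^- 2.
    rewrite (_ : s i ^+ 4 = (s i ^+ 2) ^+ 2); last by rewrite -exprM.
    by rewrite -exprVn lerXn2r// nnegrE ?sqr_ge0// invr_ge0 ltW.
  apply: (@le_trans _ _ (K * s i ^+ 4)); last by rewrite ler_wpM2l.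
  by rewrite ler_wpM2r ?exprn_even_ge0// lerBlDr lerDl.
have {}cheb : (Q [set w : seqspace R | (t <= `|\sum_(i < k) (w : nat -> R) i ^+ 2 - M|)%R]
    <= (V / t ^+ 2)%:E)%E.
  by apply: le_trans cheb _; rewrite lee_fin.
pose SS (f : seqspace R) : R := \sum_(i < k) (f : nat -> R) i ^+ 2.
have mSS : measurable_fun setT SS.
  apply: (@measurable_sum _ _ _ _ _ _
    (fun (i : 'I_k) (f : seqspace R) => (f : nat -> R) i ^+ 2)) => i.
  by apply: measurable_funX; exact: measurable_coord.
have mD : measurable [set w : seqspace R | t <= `|SS w - M|].
  rewrite (_ : mkset _ = setT `&` [set w | (t%:E <= (`|SS w - M|)%:E)%E]).
    apply: emeasurable_fun_c_infty => //; apply/measurable_EFinP.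
    by apply: measurableT_comp => //; exact: measurable_funB.
  by rewrite setTI; apply/seteqP; split => f /=; rewrite lee_fin.
have mA : measurable [set w : seqspace R | SS w <= tau ^+ 2].
  rewrite (_ : mkset _ = setT `&` [set w | ((SS w)%:E <= (tau ^+ 2)%:E)%E]).
    by apply: emeasurable_fun_infty_c => //; exact/measurable_EFinP.
  by rewrite setTI; apply/seteqP; split => f /=; rewrite lee_fin.
set A := [set w : seqspace R | SS w <= tau ^+ 2] in mA.
have QA : Q A \is a fin_num by exact: fin_num_measure.
split => H.
- have h : (1 - Q A <= (V / t ^+ 2)%:E)%E.
    rewrite -(probability_setC Q mA); apply: le_trans cheb.
    apply: le_measure; rewrite ?inE//; first exact: measurableC.
    move=> w /= /negP; rewrite -ltNge => h.
    rewrite ger0_norm -/(SS w); lra.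
  by move: h; rewrite -(fineK QA) -EFinB lee_fin /=; lra.
- rewrite -lee_fin fineK//; apply: le_trans cheb.
  apply: le_measure; rewrite ?inE//.
  move=> w /= h; rewrite ler0_norm -/(SS w); move: h; rewrite -/(SS w); lra.
Qed.

(** The shrunk observation is affine in the noise, with mean [a i * f i] and scale [a i / sqrt n];
    [a i <= 1] then removes the shrinkage from the variance bound. *)
Lemma data_chebyshev d (Omega : measurableType d) (P : probability Omega R)
    (eps : nat -> {RV P >-> R}) (n k : nat) (a f : nat -> R) (t : R) :
  iid_standard_normal eps -> (0 < n)%N -> (forall i, 0 <= a i <= 1) -> 0 < t ->
  let E := [set w | t <= `|\sum_(i < k) (a i * observation eps n f w i) ^+ 2 -
         \sum_(i < k) a i ^+ 2 * (f i ^+ 2 + n%:R^-1)|] in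
  measurable E /\
  (P E <= ((4 * (\sum_(i < k) f i ^+ 2) / n%:R + K * (k%:R / n%:R ^+ 2)) /
           t ^+ 2)%:E)%E.
Proof.
move=> [indep law] n0 a01 t0 E.
have nR : 0 < n%:R :> R by rewrite ltr0n.
pose s i := a i / Num.sqrt n%:R.
pose m i := a i * f i.
have sn2 : Num.sqrt n%:R ^+ 2 = n%:R :> R by rewrite sqr_sqrtr// ltW.
have sn0 : Num.sqrt n%:R != 0 :> R by rewrite gt_eqF// sqrtr_gt0.
have s2 i : s i ^+ 2 = a i ^+ 2 / n%:R by rewrite /s expr_div_n sn2.
have meps i : measurable_fun setT (eps i) by [].
have rect (B : nat -> set R) : (forall i, measurable (B i)) ->
    P [set w | forall i, (i < k)%N -> B i (eps i w)] =
    (\prod_(i < k) normal_prob 0 1 (B i))%E.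
  move=> mB; have := indep (iota 0 k) B (iota_uniq 0 k) mB.
  rewrite (_ : \bigcap_(i in _) _ = [set w | forall i, (i < k)%N -> B i (eps i w)]).
    move=> ->; rewrite (_ : iota 0 k = index_iota 0 k) ?big_mkord; last first.
      by rewrite /index_iota subn0.
    by apply: eq_bigr => i _; exact: law.
  apply/seteqP; split => w /= H i ik; apply: H => /=.
    by rewrite mem_iota add0n.
  by move: ik; rewrite /= mem_iota add0n.
pose v i := 4 * m i ^+ 2 * s i ^+ 2 + (K - 1) * s i ^+ 4.
have mlin i : measurable_fun setT (fun z : R => (m i + s i * z) ^+ 2).
  by apply: measurable_funX; apply: measurable_funD => //; exact: measurable_funM.
have cheb := @chebyshev_sum _ _ Omega (measurableTypeR R) R P k
  eps (fun=> normal_prob 0 1) meps rect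
  (fun i z => (m i + s i * z) ^+ 2) (fun i => m i ^+ 2 + s i ^+ 2) v
  (fun i z => sqr_ge0 _) mlin
  (fun i _ => (normal_sq_moments (m i) (s i)).1)
  (fun i _ => (normal_sq_moments (m i) (s i)).2) t t0.
have YE w : \sum_(i < k) (m i + s i * eps i w) ^+ 2 =
    \sum_(i < k) (a i * observation eps n f w i) ^+ 2.
  apply: eq_bigr => i _; congr (_ ^+ 2).
  by rewrite /observation /m /s mulrDr [a i / _ * _]mulrAC mulrA.
have mE : \sum_(i < k) (m i ^+ 2 + s i ^+ 2) =
    \sum_(i < k) a i ^+ 2 * (f i ^+ 2 + n%:R^-1).
  by apply: eq_bigr => i _; rewrite s2 /m mulrDr exprMn.
have EE : [set w | t <= `|\sum_(i < k) (m i + s i * eps i w) ^+ 2 -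
    \sum_(i < k) (m i ^+ 2 + s i ^+ 2)|] = E.
  by apply/seteqP; split => w; rewrite /E/= YE mE.
rewrite EE in cheb; split.
  rewrite -EE (_ : mkset _ = setT `&` [set w |
    (t%:E <= (`|\sum_(i < k) (m i + s i * eps i w) ^+ 2 -
      \sum_(i < k) (m i ^+ 2 + s i ^+ 2)|)%:E)%E]).
    apply: emeasurable_fun_c_infty => //; apply/measurable_EFinP.
    apply: measurableT_comp => //; apply: measurable_funB => //.
    apply: (@measurable_sum _ _ _ _ _ _
      (fun (i : 'I_k) w => (m i + s i * eps i w) ^+ 2)) => i.
    exact: (measurableT_comp (mlin i) (meps i)).
  by rewrite setTI; apply/seteqP; split => w /=; rewrite lee_fin.
apply: le_trans cheb _; rewrite lee_fin ler_pM2r ?invr_gt0 ?exprn_gt0//.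
rewrite (_ : 4 * _ / _ + _ = \sum_(i < k) (4 * f i ^+ 2 / n%:R + K / n%:R ^+ 2)); last first.
  rewrite big_split/= -mulr_suml -mulr_sumr sumr_const card_ord.
  by congr (_ + _); rewrite -mulr_natl; ring.
apply: ler_sum => i _; rewrite /v; have K0 := normal_fourth_moment_ge0.
have /andP[a0 a1] := a01 i.
have a2 : a i ^+ 2 <= 1 by rewrite exprn_ile1.
have a20 : 0 <= a i ^+ 2 by exact: sqr_ge0.
have sn : s i ^+ 2 <= n%:R^-1 by rewrite s2 ler_piMl// invr_ge0 ltW.
have mf : m i ^+ 2 <= f i ^+ 2 by rewrite /m exprMn ler_piMl// sqr_ge0.
apply: lerD.
  apply: ler_pM => //; [by rewrite mulr_ge0// sqr_ge0|exact: sqr_ge0|].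
  by rewrite ler_wpM2l.
have s4 : s i ^+ 4 <= n%:R ^- 2.
  rewrite (_ : s i ^+ 4 = (s i ^+ 2) ^+ 2); last by rewrite -exprM.
  by rewrite -exprVn lerXn2r// nnegrE ?sqr_ge0// invr_ge0 ltW.
apply: (@le_trans _ _ (K * s i ^+ 4)); last by rewrite ler_wpM2l.
by rewrite ler_wpM2r ?exprn_even_ge0// lerBlDr lerDl.
Qed.

End chebyshev.

(** * Rates *)

Section rates.
Context (R : realType) (s : R) (n : nat).
Hypotheses (hs : 0 < s) (n0 : (0 < n)%N).
Local Notation k := (cutoff s n).
Local Notation d := (4 * s + 1).

(** The square of the minimax testing rate over a Sobolev ball; [separation_rate] is [v n] times its
    square root. *)
Definition testing_rate_sq : R := n%:R `^ (- (4 * s / d)).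
Local Notation q := testing_rate_sq.

Let nR : 0 < n%:R :> R. Proof. by rewrite ltr0n. Qed.
Let n1 : 1 <= n%:R :> R. Proof. by rewrite ler1n. Qed.
Let d0 : 0 < d. Proof. have h := hs; lra. Qed.

Lemma testing_rate_sq_gt0 : 0 < q.
Proof. exact: powR_gt0. Qed.

Lemma testing_rate_sqV : n%:R `^ (4 * s / d) = q^-1.
Proof. by rewrite /q powRN invrK. Qed.

Lemma separation_rate_sq (v : nat -> R) :
  separation_rate s v n ^+ 2 = v n ^+ 2 * q.
Proof.
rewrite /separation_rate exprMn; congr (_ * _).
by rewrite -powR_mulrn ?powR_ge0// -powRrM /q; congr (_ `^ _); ring.
Qed.

(** The choice of the cutoff: [2 - 8 * s / (4 * s + 1) = 2 / (4 * s + 1)], so the noise contribution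
    to the standard deviation of the squared norm, of order sqrt k / n, matches the bias [q] of
    truncation. *)
Lemma cutoff_le_rate : k%:R / n%:R ^+ 2 <= q ^+ 2.
Proof.
rewrite ler_pdivrMr ?exprn_gt0//.
have -> : q ^+ 2 * n%:R ^+ 2 = n%:R `^ (2 / d).
  rewrite -powR_mulrn ?powR_ge0// -powRrM -[n%:R ^+ 2]powR_mulrn ?ler0n//.
  rewrite -powRD; last by apply/implyP => _; rewrite gt_eqF.
  by congr (_ `^ _); field; rewrite gt_eqF.
by rewrite /cutoff truncn_le powR_ge0.
Qed.

Lemma inv_le_rate : n%:R^-1 <= q.
Proof.
rewrite -[n%:R^-1](powRr1 (_ : 0 <= n%:R^-1)) ?invr_ge0// -powR_inv1//.
rewrite -powRrM; apply: ler_powR => //.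
by rewrite mulr1 lerN2 ler_pdivrMr// mul1r lerDl.
Qed.

(** Indices start at 0, so [i.+1] is at least [k.+1], which exceeds the untruncated cutoff; the
    power [2 * s] of the latter is exactly [q^-1]. *)
Lemma rate_lt_index (i : nat) : (k <= i)%N -> 1 <= q * i.+1%:R `^ (2 * s).
Proof.
move=> ki; rewrite mulrC -ler_pdivrMr ?testing_rate_sq_gt0// mul1r -testing_rate_sqV.
have -> : 4 * s / d = (2 / d) * (2 * s) by field; rewrite gt_eqF.
rewrite (powRrM n%:R (2 / d)); apply: ge0_ler_powR; rewrite ?nnegrE ?powR_ge0//.
  by rewrite mulr_ge0// ltW.
have /ltW/le_trans := truncnS_gt (n%:R `^ (2 / d) : R); apply.
by rewrite ler_nat ltnS.
Qed.

Lemma sobolev_head (L : R) (f : nat -> R) (r : R) : sobolev s L f -> 0 <= r ->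
  (r%:E < l2norm f)%E -> r ^+ 2 < \sum_(i < k) f i ^+ 2 + L * q.
Proof.
move=> [_ fL] r0; rewrite l2norm_gt//.
have f0 i : (0 <= (f i ^+ 2)%:E)%E by rewrite lee_fin sqr_ge0.
have q0 := testing_rate_sq_gt0.
rewrite (@nneseries_split _ _ 0 k)//= add0n big_mkord sumEFin.
have tail : (\sum_(k <= i <oo) (f i ^+ 2)%:E <= (L * q)%:E)%E.
  rewrite eseries_cond eseries_mkcond.
  apply: (@le_trans _ _
    (\sum_(0 <= i <oo) q%:E * (f i ^+ 2 * i.+1%:R `^ (2 * s))%:E)%E).
    apply: lee_nneseries => i; first by case: ifP.
    move=> _ /=; case: ifP => ki; last first.
      by apply: mule_ge0; rewrite lee_fin ?(ltW q0)// mulr_ge0 ?sqr_ge0 ?powR_ge0.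
    rewrite -EFinM lee_fin mulrCA; apply: ler_peMr; first exact: sqr_ge0.
    exact: rate_lt_index.
  rewrite nneseriesZl; last by move=> i _; rewrite lee_fin mulr_ge0 ?sqr_ge0 ?powR_ge0.
  by rewrite [(L * q)%R]mulrC EFinM; apply: lee_wpmul2l => //; rewrite lee_fin ltW.
move=> /lt_le_trans/(_ (leeD2l _ tail)); by rewrite -EFinD lte_fin.
Qed.

(** * Bounds on the shrinkage factors *)

Section precisions.
Variable prec : nat -> R.
Hypotheses (prec_gt0 : forall i, 0 < prec i)
  (prec_incr : forall i j : nat, (i <= j)%N -> prec i <= prec j)
  (prec_le : prec k.-1 <= n%:R `^ (4 * s / d)).
Local Notation a i := (n%:R / (n%:R + prec i)).

Lemma shrinkage_itv i : 0 <= a i <= 1.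
Proof.
have np : 0 < n%:R + prec i by rewrite addr_gt0.
apply/andP; split; first by rewrite divr_ge0// ltW.
by rewrite ler_pdivrMr// mul1r lerDl ltW.
Qed.

Let prec_rate i : (i < k)%N -> prec i <= q^-1.
Proof.
move=> ik; rewrite -testing_rate_sqV; apply: le_trans prec_le.
by apply: prec_incr; rewrite -ltnS prednK// (leq_ltn_trans _ ik).
Qed.

(** Below the cutoff [prec i <= q^-1 <= n], so shrinkage at most halves an observation. *)
Lemma shrinkage_sq_ge i : (i < k)%N -> 4^-1 <= a i ^+ 2.
Proof.
move=> ik; have np : 0 < n%:R + prec i by rewrite addr_gt0.
have : 2^-1 <= a i.
  rewrite ler_pdivlMr//; have := prec_rate ik.
  have : q^-1 <= n%:R by rewrite invf_ple ?posrE ?testing_rate_sq_gt0// inv_le_rate.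
  lra.
nra.
Qed.

(** With [u = prec i / n], [a i ^+ 2 = (1 + u) ^- 2 >= 1 - 3 * u]; as [prec i <= q^-1], the total
    loss is at most [3 * k / (q * n ^+ 2) <= 3 * q]. The constant bound 1/4 on [a i ^+ 2] would
    instead lose a multiple of [k / n], which is of larger order than [q]. *)
Lemma shrinkage_sum_ge :
  k%:R / n%:R - 3 * q <= \sum_(i < k) a i ^+ 2 / n%:R.
Proof.
have q0 := testing_rate_sq_gt0.
apply: (@le_trans _ _ (\sum_(i < k) (n%:R^-1 - 3 / (q * n%:R ^+ 2)))).
  rewrite sumr_const card_ord -[leRHS]mulr_natl mulrBr lerB//.
  have := cutoff_le_rate; set x := _ / _ => h.
  have -> : k%:R * (3 / (q * n%:R ^+ 2)) = 3 * (x / q).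
    by rewrite /x; field; rewrite !gt_eqF.
  by rewrite ler_pM2l// ler_pdivrMr// -expr2.
apply: ler_sum => i _; have np : 0 < n%:R + prec i by rewrite addr_gt0.
have pq := prec_rate (ltn_ord i).
apply: (@le_trans _ _ (n%:R^-1 - 3 * prec i / n%:R ^+ 2)).
  apply: lerB => //; rewrite (_ : 3 / (q * _) = 3 * q^-1 / n%:R ^+ 2).
    by rewrite ler_pM2r ?invr_gt0 ?exprn_gt0// ler_pM2l.
  by rewrite invfM mulrA.
have p0 := prec_gt0 i.
rewrite expr_div_n.
rewrite -subr_ge0.
(* Over the common denominator, the numerator has only positive coefficients. *)
have -> : n%:R ^+ 2 / (n%:R + prec i) ^+ 2 / n%:R - (n%:R^-1 - 3 * prec i / n%:R ^+ 2) =
  (prec i * n%:R ^+ 2 + 5 * prec i ^+ 2 * n%:R + 3 * prec i ^+ 3) /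
  (n%:R ^+ 2 * (n%:R + prec i) ^+ 2).
  by field; rewrite !gt_eqF.
apply: divr_ge0; last by rewrite mulr_ge0// sqr_ge0.
by rewrite !addr_ge0// !mulr_ge0// ?exprn_ge0// ltW.
Qed.

End precisions.
End rates.

(** * Error bounds *)

Section errors.
Context (R : realType) (s : R) d (Omega : measurableType d)
  (P : probability Omega R) (eps : nat -> {RV P >-> R}).
Variables (v prec : nat -> R) (n : nat) (Pi : probability (seqspace R) R)
  (g0 g1 : R).
Local Notation k := (cutoff s n).
Local Notation q := (testing_rate_sq s n).
Local Notation K := (normal_fourth_moment R).
Local Notation test :=
  (bayes_test g0 g1 Pi n (test_radius s 8^-1 v prec n)).
Hypotheses (hs : 0 < s) (heps : iid_standard_normal eps) (n0 : (0 < n)%N)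
  (prec_gt0 : forall i, 0 < prec i)
  (prec_incr : forall i j : nat, (i <= j)%N -> prec i <= prec j)
  (prec_le : prec k.-1 <= n%:R `^ (4 * s / (4 * s + 1)))
  (hPi : truncated_gaussian_prior k prec Pi) (v0 : 0 < v n).

Let a i := n%:R / (n%:R + prec i).
Let A : R := \sum_(i < k) (n%:R + prec i)^-1.

Let test_radius_sq : test_radius s 8^-1 v prec n ^+ 2 =
  v n ^+ 2 * q / 16 + k%:R / n%:R + A.
Proof.
rewrite /test_radius separation_rate_sq sqr_sqrtr.
  by congr (_ + _ + _); field.
have q0 := testing_rate_sq_gt0 s n0.
rewrite !addr_ge0//; last first.
  by apply: sumr_ge0 => i _; rewrite invr_ge0 addr_ge0// ltW.
by rewrite divr_ge0// mulr_ge0// mulr_ge0 ?sqr_ge0// ltW.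
Qed.

Let rates : [/\ (0 : R) < q, (0 : R) < n%:R^-1, (n%:R^-1 : R) <= q,
  (0 : R) <= k%:R / n%:R ^+ 2 & (k%:R / n%:R ^+ 2 : R) <= q ^+ 2].
Proof.
split; [exact: testing_rate_sq_gt0|by rewrite invr_gt0 ltr0n|exact: inv_le_rate| |
  exact: cutoff_le_rate].
by rewrite divr_ge0// sqr_ge0.
Qed.

Let shrinkage_le1 i : 0 <= a i ^+ 2 <= 1.
Proof.
have /andP[a0 a1] := shrinkage_itv n0 prec_gt0 i.
by rewrite sqr_ge0 exprn_ile1.
Qed.

Let centering_le (f : nat -> R) :
  \sum_(i < k) a i ^+ 2 * (f i ^+ 2 + n%:R^-1) <=
  \sum_(i < k) f i ^+ 2 + k%:R / n%:R.
Proof.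
have [q0 nV0 _ _ _] := rates.
have -> : k%:R / n%:R = \sum_(i < k) n%:R^-1 :> R.
  by rewrite sumr_const card_ord mulr_natl.
rewrite -big_split/=; apply: ler_sum => i _.
have /andP[a0 a1] := shrinkage_le1 i.
by apply: ler_piMl => //; rewrite addr_ge0 ?sqr_ge0// ltW.
Qed.

(** Signal and noise are bounded differently: a constant factor suffices for the signal, while the
    noise must keep [k / n] up to order [q] in order to cancel against [test_radius]. *)
Let centering_ge (f : nat -> R) :
  4^-1 * (\sum_(i < k) f i ^+ 2) + k%:R / n%:R - 3 * q <=
  \sum_(i < k) a i ^+ 2 * (f i ^+ 2 + n%:R^-1).
Proof.
under [leRHS]eq_bigr do rewrite mulrDr.
rewrite big_split/= -addrA; apply: lerD.
  rewrite mulr_sumr; apply: ler_sum => i _.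
  rewrite ler_wpM2r ?sqr_ge0//.
  exact: (shrinkage_sq_ge hs n0 prec_gt0 prec_incr prec_le).
exact: (shrinkage_sum_ge hs n0 prec_gt0 prec_incr prec_le).
Qed.

Lemma type1_error_le (x : R) : x = 32 / v n ^+ 2 ->
  (4 + K) * x ^+ 2 + 4 * x <= 1 - g0 / (g0 + g1) ->
  (type1_error eps n test <= (K * x ^+ 2)%:E)%E.
Proof.
move=> xE hx; have [q0 nV0 nq kn0 kq] := rates.
have K0 := normal_fourth_moment_ge0 R.
have v20 : 0 < v n ^+ 2 by rewrite exprn_gt0.
have x0 : 0 < x by rewrite xE divr_gt0.
(* [t] is half of the gap [v n ^+ 2 * q / 16] left in the squared radius: one half absorbs the
   deviation of [S] from its mean, the other the posterior deviation. *)
pose t := q / x.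
have t0 : 0 < t by rewrite divr_gt0.
have tE : t = v n ^+ 2 * q / 32 by rewrite /t xE; field; rewrite gt_eqF.
have qt : q = x * t by rewrite /t; field; rewrite gt_eqF.
have [mE PE] := data_chebyshev k (fun=> 0) heps n0 (shrinkage_itv n0 prec_gt0)
  t0.
set E := [set w | _] in mE PE.
apply: (@le_trans _ _ (P E)); last first.
  apply: le_trans PE _; rewrite lee_fin ler_pdivrMr ?exprn_gt0//.
  rewrite big1 ?mulr0 ?mul0r ?add0r; last by move=> i _; rewrite expr0n.
  rewrite -mulrA -exprMn -qt; exact: ler_wpM2l.
apply: expectation_le_prob => // w; rewrite indicE /bayes_test.
case: (boolP (w \in E)) => [_|].
  by case: ifP; rewrite ?lexx ?ler01.
rewrite notin_setE /E /= => /negP; rewrite -ltNge => Ew.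
set y := observation _ _ _ _.
have tau0 : 0 <= test_radius s 8^-1 v prec n by exact: sqrtr_ge0.
have [H _] := posterior_chebyshev y n0 prec_gt0 hPi t0 tau0.
have := centering_le (fun=> 0).
rewrite [X in _ <= X + _ -> _]big1 ?add0r => [mk|i _]; last by rewrite expr0n.
move: Ew H; rewrite test_radius_sq -/A /a in mk *.
set m := \sum_(i < k) _ * _ in mk *; set S := \sum_(i < k) _ ^+ 2.
rewrite ltr_norml => /andP[_ Sm] H.
rewrite ifT ?lexx//; apply: le_trans (H _); last by rewrite tE in Sm *; lra.
suff : (4 * S / n%:R + K * (k%:R / n%:R ^+ 2)) / t ^+ 2 <=
    (4 + K) * x ^+ 2 + 4 * x by lra.
rewrite ler_pdivrMr ?exprn_gt0//.
(* Off [E], [S <= k / n + t]; after division by [n] the two terms are at most [q ^+ 2] and [t * q],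
   with [q = x * t]. *)
have h1 : S / n%:R <= x ^+ 2 * t ^+ 2 + x * t ^+ 2.
  have : S / n%:R <= (k%:R / n%:R + t) / n%:R by rewrite ler_pM2r//; lra.
  have : t / n%:R <= t * q by rewrite ler_pM2l.
  have -> : (k%:R / n%:R + t) / n%:R = k%:R / n%:R ^+ 2 + t / n%:R :> R.
    by field; rewrite gt_eqF// ltr0n.
  have := kq; rewrite qt; lra.
have h2 : K * (k%:R / n%:R ^+ 2) <= K * (x ^+ 2 * t ^+ 2).
  by rewrite ler_wpM2l// -exprMn -qt.
lra.
Qed.

(** For every signal of the alternative [q <= x * F], [F] being the energy below the cutoff.
    Variances of order [F * q] and [q ^+ 2] are thus small multiples of [F ^+ 2], the scale of the
    squared deviation, uniformly in the signal. *)
Lemma type2_error_le (L x : R) :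
  0 < L -> L < v n ^+ 2 -> x = (v n ^+ 2 - L)^-1 ->
  (48 + L) * x <= 1 ->
  256 * ((4 + K) * x ^+ 2 + 8 * x) < g0 / (g0 + g1) ->
  (type2_error eps n s L (separation_rate s v n) test <=
   (256 * (K * x ^+ 2 + 4 * x))%:E)%E.
Proof.
move=> L0 Lv xE hx1 hx2; have [q0 nV0 nq kn0 kq] := rates.
have K0 := normal_fourth_moment_ge0 R.
have x0 : 0 < x by rewrite xE invr_gt0 subr_gt0.
rewrite /type2_error ge_max lee_fin; apply/andP; split.
  by rewrite mulr_ge0// addr_ge0// mulr_ge0// ?sqr_ge0// ltW.
apply: ub_ereal_sup => _ [f [fS _ fr] <-].
have r0 : 0 <= separation_rate s v n by rewrite mulr_ge0 ?powR_ge0// ltW.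
have := sobolev_head hs n0 fS r0 fr; rewrite separation_rate_sq.
set F := \sum_(i < k) _ => vF.
have qxF : q <= x * F.
  by rewrite xE mulrC ler_pdivlMr ?subr_gt0//; lra.
have F0 : 0 < F.
  by rewrite -(pmulr_rgt0 _ x0); apply: lt_le_trans qxF.
(* The energy [F / 4] that survives shrinkage is cut into four shares [F / 16]: one for the
   deviation of [S], one for the posterior deviation, one for the threshold term
   [v n ^+ 2 * q / 16 < (F + L * q) / 16]. The last has to cover
   [3 * q + L * q / 16 = (48 + L) * q / 16]. *)
have Fq : (48 + L) * q <= F.
  have h : (48 + L) * q <= (48 + L) * (x * F) by rewrite ler_pM2l//; lra.
  apply: le_trans h _; rewrite mulrA; apply: ler_piMl => //; exact: ltW.
have Fq1 : F * q <= x * F ^+ 2 by rewrite expr2 mulrCA ler_pM2l.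
have Fq2 : q ^+ 2 <= x ^+ 2 * F ^+ 2.
  by rewrite -exprMn lerXn2r// nnegrE ?(ltW q0)// mulr_ge0// ltW.
pose t := F / 16.
have t0 : 0 < t by rewrite divr_gt0.
have tF : t ^+ 2 = F ^+ 2 / 256 by rewrite /t; field.
have kqx : K * (k%:R / n%:R ^+ 2) <= K * (x ^+ 2 * F ^+ 2).
  by rewrite ler_wpM2l// (le_trans kq).
have [mE PE] := data_chebyshev k f heps n0 (shrinkage_itv n0 prec_gt0)
  t0.
set E := [set w | _] in mE PE.
apply: (@le_trans _ _ (P E)); last first.
  apply: le_trans PE _; rewrite lee_fin ler_pdivrMr ?exprn_gt0// -/F tF.
  have : F / n%:R <= F * q by rewrite ler_pM2l.
  lra.
apply: expectation_le_prob => // w; rewrite indicE /bayes_test.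
case: (boolP (w \in E)) => [_|].
  by case: ifP; rewrite ?subrr ?subr0 ?lexx ?ler01.
rewrite notin_setE /E /= => /negP; rewrite -ltNge => Ew.
set y := observation _ _ _ _ in Ew *.
have tau0 : 0 <= test_radius s 8^-1 v prec n by exact: sqrtr_ge0.
have [_ H] := posterior_chebyshev y n0 prec_gt0 hPi t0 tau0.
have := centering_le f; have := centering_ge f; rewrite -/F.
move: Ew H; rewrite test_radius_sq -/A /a.
set m := \sum_(i < k) _ * _; set S := \sum_(i < k) _ ^+ 2.
rewrite ltr_norml => /andP[mS Sm] H m1 m2.
rewrite ifF ?subrr ?lexx//; apply/negbTE; rewrite -ltNge.
apply: le_lt_trans (H _) _; first by rewrite /t in mS *; lra.
apply: le_lt_trans hx2; rewrite ler_pdivrMr ?exprn_gt0// tF.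
have h1 : S / n%:R <= x ^+ 2 * F ^+ 2 + 2 * x * F ^+ 2.
  have : S / n%:R <= (k%:R / n%:R + 2 * F) / n%:R.
    by rewrite ler_pM2r//; rewrite /t in Sm; lra.
  have : F / n%:R <= F * q by rewrite ler_pM2l.
  have -> : (k%:R / n%:R + 2 * F) / n%:R = k%:R / n%:R ^+ 2 + 2 * (F / n%:R) :> R.
    by field; rewrite gt_eqF// ltr0n.
  lra.
lra.
Qed.

End errors.

(** * Passage to the limit *)

Lemma cvg_inv_sq_affine (R : realType) (v : nat -> R) (c L : R) :
  0 < c -> v @ \oo --> +oo -> (fun n => (c * v n ^+ 2 - L)^-1) @ \oo --> 0.
Proof.
move=> c0 voo.
have h : (fun n => c * v n ^+ 2 - L) @ \oo --> +oo.
  apply/cvgryPge => A; near=> n.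
  have v1 : 1 <= v n by near: n; move/cvgryPge : voo; exact.
  have vA : c^-1 * (A + L) <= v n by near: n; move/cvgryPge : voo; exact.
  rewrite lerBrDr -(ler_pM2l (_ : 0 < c^-1)) ?invr_gt0// mulKf ?gt_eqF//.
  by apply: le_trans vA _; rewrite expr2 ler_peMr//; lra.
apply/gtr0_cvgV0.
  near=> n.
  have : 1 <= c * v n ^+ 2 - L by near: n; move/cvgryPge : h; exact.
  lra.
exact: h.
Unshelve. all: by end_near. Qed.

Lemma bayes_test01 (R : realType) (g0 g1 : R) (Pi : probability (seqspace R) R)
  (n : nat) (tau : R) (y : nat -> R) : 0 <= bayes_test g0 g1 Pi n tau y <= 1.
Proof. by rewrite /bayes_test; case: ifP; rewrite ?lexx ?ler01. Qed.

Theorem theorem2 (R : realType) (s L : R) (hs : 0 < s) (hL : 0 < L)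
    (d : measure_display) (Omega : measurableType d) (P : probability Omega R)
    (eps : nat -> {RV P >-> R}) (heps : iid_standard_normal eps)
    (v : nat -> R)
    (v_incr : forall m n : nat, (m <= n)%N -> v m <= v n)
    (v_infty : v @ \oo --> +oo)
    (prec : nat -> R)
    (prec_gt0 : forall i : nat, 0 < prec i)
    (prec_incr : forall i j : nat, (i <= j)%N -> prec i <= prec j)
    (prec_le : forall n : nat, (0 < n)%N ->
       prec (cutoff s n).-1 <= n%:R `^ (4 * s / (4 * s + 1)))
    (prec_sum : forall n : nat, (0 < n)%N ->
       \sum_(i < cutoff s n) (n%:R + prec i)^-1 <= separation_rate s v n / 4)
    (Pi : nat -> probability (seqspace R) R)
    (hPi : forall n : nat, (0 < n)%N ->
       truncated_gaussian_prior (cutoff s n) prec (Pi n))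
    (g0 g1 : R) (hg0 : 0 < g0) (hg1 : 0 < g1) :
  exists C : R, 0 < C /\
    let test := fun n : nat =>
      bayes_test g0 g1 (Pi n) n (test_radius s C v prec n) in
    ((fun n : nat => type1_error eps n (test n)) @ \oo --> 0%E) /\
    ((fun n : nat => type2_error eps n s L (separation_rate s v n) (test n))
       @ \oo --> 0%E).
Proof.
(* With this constant the radius exceeds its centring by [v n ^+ 2 * q / 16], about a quarter of the
   share [F / 4] of the signal that survives shrinkage, which leaves room for both deviations. *)
exists 8^-1; split; first by rewrite invr_gt0.
have gg : 0 < g0 + g1 by rewrite addr_gt0.
have level0 : 0 < g0 / (g0 + g1) by rewrite divr_gt0.
have level1 : 0 < 1 - g0 / (g0 + g1).
  by rewrite subr_gt0 ltr_pdivrMr// mul1r ltrDl.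
(* Error bounds and smallness conditions are all polynomials in [x n] without constant term, so the
   former vanish and the latter hold eventually. *)
have poly0 (a b : R) (x : nat -> R) : x @ \oo --> 0 ->
    (fun n => a * x n ^+ 2 + b * x n) @ \oo --> 0.
  move=> x0; rewrite -[X in _ --> X](_ : a * (0 * 0) + b * 0 = 0); last by ring.
  apply: cvgD; apply: cvgMr => //.
  by under eq_fun do rewrite expr2; exact: cvgM.
set K := normal_fourth_moment R.
split.
(* This is [32 / v n ^+ 2], put in the affine form shared with the type II case. *)
- pose x n := (32^-1 * v n ^+ 2 - 0)^-1.
  have x0 : x @ \oo --> 0 by apply: cvg_inv_sq_affine.
  apply: (@squeeze_cvge _ _ _ _ (fun=> 0%E) _ (fun n => (K * x n ^+ 2 + 0 * x n)%:E)).
  + near=> n; apply/andP; split.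
      by apply: expectation_ge0 => w; case/andP: (bayes_test01 g0 g1 (Pi n) n
        (test_radius s 8^-1 v prec n) (observation eps n (fun=> 0) w)).
    have n0 : (0 < n)%N by near: n; exact: nbhs_infty_gt.
    rewrite mul0r addr0; apply: type1_error_le => //.
    * exact: hPi.
    * by near: n; move/cvgryPgt : v_infty; exact.
    * by rewrite /x subr0 invfM invrK.
    * by apply: ltW; near: n; apply: (cvgr_lt 0) => //; exact: poly0.
  + exact: cvg_cst.
  + by apply: cvg_EFin; [exact: nearW|exact: poly0].
- pose x n := (1 * v n ^+ 2 - L)^-1.
  have x0 : x @ \oo --> 0 by apply: cvg_inv_sq_affine.
  apply: (@squeeze_cvge _ _ _ _ (fun=> 0%E) _
    (fun n => (256 * K * x n ^+ 2 + 1024 * x n)%:E)).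
  + near=> n; apply/andP; split; first by rewrite /type2_error le_max lexx.
    have n0 : (0 < n)%N by near: n; exact: nbhs_infty_gt.
    rewrite (_ : _ + _ = 256 * (K * x n ^+ 2 + 4 * x n)); last by ring.
    have v1 : 1 <= v n by near: n; move/cvgryPge : v_infty; exact.
    have vL : L < v n by near: n; move/cvgryPgt : v_infty; exact.
    apply: type2_error_le => //.
    * exact: prec_le.
    * exact: hPi.
    * by apply: lt_le_trans ltr01 _.
    * by apply: lt_le_trans vL _; rewrite expr2 ler_peMr//; lra.
    * by rewrite /x mul1r.
    * rewrite (_ : _ * x n = 0 * x n ^+ 2 + (48 + L) * x n); last by ring.
      by apply: ltW; near: n; apply: (cvgr_lt 0) => //; exact: poly0.
    * rewrite -/K (_ : 256 * _ = 256 * (4 + K) * x n ^+ 2 + 2048 * x n); last by ring.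
      by near: n; apply: (cvgr_lt 0) => //; exact: poly0.
  + exact: cvg_cst.
  + by apply: cvg_EFin; [exact: nearW|exact: poly0].
Unshelve. all: by end_near. Qed.
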